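(* Consider the algebraic structure consisting of a vector space with a single endomorphism (type $((1,1))$), and let $d\ge0$. The ideal $t(I_d)$ of $K[X]=K[X_1,X_2,\ldots]$ is equal to $(X_{d+1},X_{d+2},\ldots)$. As a result, $K[X]/I_d\cong K[X_1,\ldots,X_d]$ is a polynomial ring in $d$ variables.
   Context: $K$ is an algebraically closed field of characteristic zero. $K[X]=\bigoplus_{n\ge0}K[X]_n$, where $K[X]_n=(KS_n)_{S_n}$ is the space of coinvariants of the conjugation action of $S_n$ on $KS_n$; the class of $\sigma\in S_n$ is denoted $\overline\sigma$. Multiplication: $\overline\sigma\cdot\overline\tau=\overline{(\sigma,\tau)}$ for $\sigma\in S_n$, $\tau\in S_m$, with $(\sigma,\tau)\in S_n\times S_m\subseteq S_{n+m}$. $I_d$ is the kernel of the surjective algebra map $\Phi_d:K[X]\to K[\mathrm{M}_d(K)]^{\mathrm{GL}_d(K)}$ (invariants under conjugation), $\overline\sigma\mapsto\big(T\mapsto\mathrm{Tr}(L^{(n)}_\sigma T^{\otimes n})\big)$, where $L^{(n)}_\sigma(w_1\otimes\cdots\otimes w_n)=w_{\sigma^{-1}(1)}\otimes\cdots\otimes w_{\sigma^{-1}(n)}$. Equivalently, $I_d$ is spanned by the elements $\{\lambda\}$ (below) for partitions $\lambda$ with more than $d$ rows. For $\lambda\vdash n$ let $\mathbb{S}_\lambda$ be the Specht module, $d_\lambda=\dim\mathbb{S}_\lambda$, $e_\lambda\in KS_n$ the corresponding central idempotent, and $\{\lambda\}=\frac1{d_\lambda}\overline{e_\lambda}\in K[X]_n$,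 where $\overline{e_\lambda}$ is the image of $e_\lambda$ in $(KS_n)_{S_n}$. The elements $\{\lambda\}$, over all partitions of all $n\in\mathbb{N}$, form a basis of $K[X]$. Under $\{\lambda\}\leftrightarrow[\mathbb{S}_\lambda]$, $K[X]$ is identified with $K\otimes_{\mathbb{Z}}\bigoplus_n\mathrm{R}(S_n)$ (Grothendieck groups of the symmetric groups with the induction product). $X_n=\{(n)\}$ is the element corresponding to the trivial representation of $S_n$; by Zelevinsky, $K[X]=K[X_1,X_2,\ldots]$ is a polynomial ring. $t:K[X]\to K[X]$ is the ($K$-linear extension of the) automorphism with $t(\{\lambda\})=\{\lambda^t\}$, $\lambda^t$ the transposed partition; it is an algebra automorphism. *)

(* Defs.v *)
From HB Require Import structures.
From mathcomp Require Import all_boot all_order all_fingroup all_algebra.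
From mathcomp Require Import all_character.
From mathcomp Require Import generic_quotient ring_quotient.
From mathcomp Require Import boolp classical_sets.
From mathcomp Require Import finmap monalg.

Set Implicit Arguments.
Unset Strict Implicit.
Unset Printing Implicit Defensive.

Import GRing.Theory.
Local Open Scope ring_scope.
Local Open Scope quotient_scope.

(* {perm T} is multiplied from left to right in MathComp: (s * t) i = t (s i).
   The group algebra written here is therefore the opposite of the one for the
   right-to-left convention, and right modules here are left modules there. *)

Section Span.
Variables (R : nzRingType) (V : lmodType R).

Definition lspan (S : set V) : set V :=
  [set v | exists r : seq (R * V),
     (forall c, c \in r -> S c.2) /\ v = \sum_(c <- r) c.1 *: c.2]%classic.

Definition in_lspan (S : set V) : {pred V} := fun v => `[< lspan S v >].

Lemma lspan0 S : lspan S 0.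
Proof. by exists [::]; rewrite big_nil. Qed.

Lemma lspanD S u v : lspan S u -> lspan S v -> lspan S (u + v).
Proof.
move=> [r [rS ->]] [r' [rS' ->]]; exists (r ++ r'); rewrite big_cat; split=> // c.
by rewrite mem_cat => /orP[/rS|/rS'].
Qed.

Lemma lspanZ S a v : lspan S v -> lspan S (a *: v).
Proof.
move=> [r [rS ->]]; exists [seq (a * c.1, c.2) | c <- r]; split.
  by move=> c /mapP[c' /rS Sc' ->].
by rewrite big_map scaler_sumr; apply: eq_bigr => c _; rewrite scalerA.
Qed.

Lemma lspan_incl S v : S v -> lspan S v.
Proof.
move=> Sv; exists [:: (1, v)]; rewrite big_seq1 scale1r; split=> // c.
by rewrite inE => /eqP->.
Qed.

Lemma lspan_sum (I : Type) (r : seq I) (f : I -> V) S :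
  (forall i, lspan S (f i)) -> lspan S (\sum_(i <- r) f i).
Proof.
by move=> fS; apply: (big_ind (lspan S)) => // [|u v]; [apply: lspan0|apply: lspanD].
Qed.

Lemma in_lspan_zmod_closed S : zmod_closed (in_lspan S).
Proof.
split=> [|u v /asboolP Su /asboolP Sv]; apply/asboolP; first exact: lspan0.
by apply: lspanD => //; rewrite -scaleN1r; apply: lspanZ.
Qed.
HB.instance Definition _ S :=
  GRing.isZmodClosed.Build V (in_lspan S) (in_lspan_zmod_closed S).
End Span.

Definition ideal_gen (A : comNzRingType) (S : set A) : set A := @lspan A A^o S.

Section AlgebraQuotient.
Variables (F : fieldType) (A : comAlgType F) (I : idealr A).

Definition quot_scale (a : F) := lift_op1 {ideal_quot I} ( *:%R a).

Lemma pi_quot_scale a :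
  {morph \pi_{ideal_quot I} : x / a *: x >-> quot_scale a x}.
Proof.
move=> x; unlock quot_scale; apply/eqP; rewrite piE Quotient.equivE.
by rewrite -scalerBr -mulr_algl idealMr // Quotient.idealrBE reprK.
Qed.
Canonical pi_quot_scale_morph a := PiMorph1 (pi_quot_scale a).

Fact quot_scaleA a b v : quot_scale a (quot_scale b v) = quot_scale (a * b) v.
Proof. by rewrite -[v]reprK !piE scalerA. Qed.
Fact quot_scale1 : left_id 1 quot_scale.
Proof. by move=> v; rewrite -[v]reprK !piE scale1r. Qed.
Fact quot_scaleDr : right_distributive quot_scale +%R.
Proof. by move=> a u v; rewrite -[u]reprK -[v]reprK !piE scalerDr. Qed.
Fact quot_scaleDl v : {morph quot_scale^~ v : a b / a + b}.
Proof. by move=> a b; rewrite -[v]reprK !piE scalerDl. Qed.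
HB.instance Definition _ := GRing.Zmodule_isLmodule.Build F (Quotient.quot I)
  quot_scaleA quot_scale1 quot_scaleDr quot_scaleDl.

Fact quot_scaleAl a (u v : {ideal_quot I}) : a *: (u * v) = a *: u * v.
Proof.
have Zpi x : a *: \pi_{ideal_quot I} x = \pi_{ideal_quot I} (a *: x).
  by rewrite [LHS]piE.
by rewrite -[u]reprK -[v]reprK -rmorphM !Zpi -rmorphM scalerAl.
Qed.
HB.instance Definition _ := GRing.Lmodule_isLalgebra.Build F (Quotient.quot I)
  quot_scaleAl.
HB.instance Definition _ :=
  GRing.Lalgebra_isComAlgebra.Build F (Quotient.quot I).
End AlgebraQuotient.

Definition symperm : Type := {n : nat & 'S_n}.
HB.instance Definition _ := Choice.on symperm.

Definition juxt_fun n m (s : 'S_n) (t : 'S_m) (i : 'I_(n + m)) : 'I_(n + m) :=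
  match split i with inl j => lshift m (s j) | inr k => rshift n (t k) end.

Lemma juxt_funl n m (s : 'S_n) (t : 'S_m) i :
  juxt_fun s t (lshift m i) = lshift m (s i).
Proof. by rewrite /juxt_fun -[lshift m i]/(unsplit (inl i)) unsplitK. Qed.

Lemma juxt_funr n m (s : 'S_n) (t : 'S_m) i :
  juxt_fun s t (rshift n i) = rshift n (t i).
Proof. by rewrite /juxt_fun -[rshift n i]/(unsplit (inr i)) unsplitK. Qed.

Lemma juxt_inj n m (s : 'S_n) (t : 'S_m) : injective (juxt_fun s t).
Proof.
apply: (can_inj (g := juxt_fun s^-1 t^-1)) => i.
rewrite -[i]splitK; case: (split i) => j /=.
  by rewrite !juxt_funl permK.
by rewrite !juxt_funr permK.
Qed.

Definition juxt n m (s : 'S_n) (t : 'S_m) : 'S_(n + m) := perm (@juxt_inj n m s t).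

Lemma juxtl n m (s : 'S_n) (t : 'S_m) i : juxt s t (lshift m i) = lshift m (s i).
Proof. by rewrite permE juxt_funl. Qed.

Lemma juxtr n m (s : 'S_n) (t : 'S_m) i : juxt s t (rshift n i) = rshift n (t i).
Proof. by rewrite permE juxt_funr. Qed.

Lemma permJ_juxt n m (s s' : 'S_n) (t t' : 'S_m) :
  juxt (s ^ s')%g (t ^ t')%g = (juxt s t ^ juxt s' t')%g.
Proof.
apply/permP => i; rewrite -[i](permKV (juxt s' t')) permJ.
set k := (juxt s' t')^-1%g i; rewrite -[k]splitK; case: (split k) => j /=.
  by rewrite !juxtl permJ.
by rewrite !juxtr permJ.
Qed.

Definition symmul (x y : symperm) : symperm :=
  Tagged (fun n => 'S_n) (juxt (tagged x) (tagged y)).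
Definition symone : symperm := Tagged (fun n => 'S_n) (1%g : 'S_0).

Lemma symperm_eq n m (s : 'S_n) (t : 'S_m) : n = m ->
  (forall (i : 'I_n) (j : 'I_m), i = j :> nat -> s i = t j :> nat) ->
  Tagged (fun n => 'S_n) s = Tagged (fun n => 'S_n) t.
Proof.
move=> eqn; case: m / eqn t => t st.
by congr Tagged; apply/permP => i; apply: val_inj; apply: st.
Qed.

Fact symmulA : associative symmul.
Proof.
move=> [n s] [m t] [p u]; apply: symperm_eq => /= [|i j]; first exact: addnA.
rewrite -[i]splitK -[j]splitK; case: (split i) => a; case: (split j) => b /=.
- rewrite -[b]splitK; case: (split b) => c /= ac.
    by rewrite !juxtl /=; congr (val (s _)); apply: val_inj.
  by have := ltn_ord a; rewrite ac ltnNge leq_addr.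
- by move=> ab; have := ltn_ord a; rewrite ab -addnA ltnNge leq_addr.
- rewrite -[a]splitK -[b]splitK; case: (split a) => c; case: (split b) => e /=.
  + by move=> ce; have := ltn_ord e; rewrite -ce ltnNge leq_addr.
  + move/addnI => ce; rewrite juxtr juxtl juxtl juxtr /=; congr (_ + _)%N.
    by congr (val (t _)); apply: val_inj.
  + by move=> ce; have := ltn_ord e; rewrite -ce ltnNge leq_addr.
  + by rewrite addnA => ce; have := ltn_ord (rshift n e); rewrite /= -ce ltnNge leq_addr.
- rewrite -[a]splitK; case: (split a) => c /=.
    rewrite addnC => cb; have := ltn_ord c.
    by rewrite -(ltn_add2r n) cb [X in (_ < X)%N]addnC ltnNge leq_addr.
  rewrite addnA => /addnI cb; rewrite !juxtr /= addnA; congr (_ + _)%N.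
  by congr (val (u _)); apply: val_inj.
Qed.

Fact symmul1m : left_id symone symmul.
Proof.
move=> [n s]; apply: symperm_eq => //= i j.
rewrite -[i]splitK; case: (split i) => [[]//|a] /= aj.
by rewrite juxtr /=; congr (val (s _)); apply: val_inj.
Qed.

Fact symmulm1 : right_id symone symmul.
Proof.
move=> [n s]; apply: symperm_eq => /= [|i j]; first exact: addn0.
rewrite -[i]splitK; case: (split i) => [a|[]//] /= aj.
by rewrite juxtl /=; congr (val (s _)); apply: val_inj.
Qed.

Fact symunitm x y : symmul x y = symone -> x = symone /\ y = symone.
Proof.
case: x y => [n s] [m t] /(congr1 (@tag _ _)) /= /eqP; rewrite addn_eq0.
case/andP => /eqP n0 /eqP m0; move: s t; rewrite n0 m0 => s t.
by split; apply: symperm_eq => // -[].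
Qed.

Definition swap_fun n m (i : 'I_(n + m)) : 'I_(n + m) :=
  cast_ord (addnC m n)
    match split i with inl j => rshift m j | inr k => lshift n k end.

Lemma swap_funl n m (i : 'I_n) : swap_fun (lshift m i) = (m + i)%N :> nat.
Proof. by rewrite /swap_fun -[lshift m i]/(unsplit (inl i)) unsplitK. Qed.

Lemma swap_funr n m (i : 'I_m) : swap_fun (rshift n i) = i :> nat.
Proof. by rewrite /swap_fun -[rshift n i]/(unsplit (inr i)) unsplitK. Qed.

Lemma swap_inj n m : injective (@swap_fun n m).
Proof.
move=> i j /(congr1 (@nat_of_ord _)).
rewrite -[i]splitK -[j]splitK; case: (split i) => a; case: (split j) => b.
- by rewrite !swap_funl => /addnI/val_inj->.
- by rewrite swap_funl swap_funr => ab; have := ltn_ord b; rewrite -ab ltnNge leq_addr.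
- by rewrite swap_funl swap_funr => ab; have := ltn_ord a; rewrite ab ltnNge leq_addr.
- by rewrite !swap_funr => /val_inj->.
Qed.

Lemma juxtC n m (s : 'S_n) (t : 'S_m) :
  Tagged (fun n => 'S_n) (juxt t s) =
  Tagged (fun n => 'S_n) (juxt s t ^ perm (@swap_inj n m))%g.
Proof.
set w := perm _; apply: symperm_eq => [|i j]; first exact: addnC.
rewrite -[j](permKV w) permJ; set k := (w^-1)%g j.
rewrite -[k]splitK -[i]splitK; case: (split k) => a; case: (split i) => b /=.
- rewrite permE swap_funl => ba; have := ltn_ord b.
  by rewrite ba ltnNge leq_addr.
- rewrite permE swap_funl => /addnI/val_inj->.
  by rewrite juxtl juxtr permE swap_funl.
- rewrite permE swap_funr => /val_inj->.
  by rewrite juxtl juxtr permE swap_funr.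
- rewrite permE swap_funr => ba; have := ltn_ord a.
  by rewrite -ba ltnNge leq_addr.
Qed.

HB.instance Definition _ := Choice_isMonomialDef.Build symperm
  symmulA symmul1m symmulm1 symunitm.

Section KX.
Variable F : fieldType.

(* The direct sum of the F S_n, with juxtaposition (not the group law) as
   product. Dividing it by the span of conj_rel takes coinvariants in each
   degree. *)
Definition symalg := {malg F[symperm]}.
HB.instance Definition _ := GRing.Lalgebra.on symalg.

Definition single n (s : 'S_n) : symalg := << Tagged (fun n => 'S_n) s >>.

Lemma single_mul n m (s : 'S_n) (t : 'S_m) :
  single s * single t = single (juxt s t) :> symalg.
Proof. by rewrite /single [LHS]fgmulUU mul1r. Qed.

Lemma symalg_sum (f : symalg) :
  f = \sum_(x <- msupp f) f@_x *: single (tagged x) :> symalg.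
Proof.
rewrite {1}[f]monalgE; apply: eq_bigr => -[n s] _.
by rewrite /single -mul_malgC [RHS]fgmulUU mulr1 mul1m.
Qed.

Definition conj_rel : set symalg :=
  [set f | exists n (s t : 'S_n), f = single (s ^ t)%g - single s]%classic.

Definition KX : Type := Quotient.quot (in_lspan conj_rel).
HB.instance Definition _ := GRing.Zmodule.on KX.
HB.instance Definition _ := EqQuotient.on KX.

Definition cls (f : symalg) : KX := \pi_KX f.
Definition bar n (s : 'S_n) : KX := cls (single s).

Lemma cls_eq f g : (cls f = cls g) <-> lspan conj_rel (f - g).
Proof.
split=> [/eqP|fg]; first by rewrite -Quotient.idealrBE => /asboolP.
by apply/eqP; rewrite -Quotient.idealrBE; apply/asboolP.
Qed.

Lemma cls_repr x : cls (repr x) = x.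
Proof. exact: reprK. Qed.

Lemma cls_is_zmod_morphism : zmod_morphism cls.
Proof. by move=> f g; rewrite /cls -[RHS]pi_is_zmod_morphism. Qed.
HB.instance Definition _ :=
  GRing.isZmodMorphism.Build symalg KX cls cls_is_zmod_morphism.

Lemma symalg_scaleAr a (f g : symalg) : f * (a *: g) = a *: (f * g).
Proof.
rewrite -!mul_malgC !mulrA; congr (_ * _).
rewrite [LHS]fgmulgU [RHS]fgmulUg; apply: eq_bigr => x _.
by rewrite mulm1 mul1m mulrC.
Qed.

Lemma lspan_conjMl (f g : symalg) : lspan conj_rel g -> lspan conj_rel (f * g).
Proof.
move=> [r [rN ->]]; rewrite mulr_sumr big_seq.
apply: (big_ind (lspan conj_rel)); [exact: lspan0|exact: lspanD|].
move=> c /rN [n [s [t ->]]]; rewrite [f]symalg_sum mulr_suml.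
apply: lspan_sum => -[m u]; rewrite -scalerAl symalg_scaleAr.
do 2!apply: lspanZ; apply: lspan_incl; rewrite mulrBr !single_mul.
by exists (m + n)%N, (juxt u s), (juxt 1%g t); rewrite -permJ_juxt conjg1.
Qed.

Lemma lspan_conjMr (f g : symalg) : lspan conj_rel f -> lspan conj_rel (f * g).
Proof.
move=> [r [rN ->]]; rewrite mulr_suml big_seq.
apply: (big_ind (lspan conj_rel)); [exact: lspan0|exact: lspanD|].
move=> c /rN [n [s [t ->]]]; rewrite [g]symalg_sum mulr_sumr.
apply: lspan_sum => -[m u]; rewrite symalg_scaleAr -scalerAl.
do 2!apply: lspanZ; apply: lspan_incl; rewrite mulrBl !single_mul.
by exists (n + m)%N, (juxt s u), (juxt t 1%g); rewrite -permJ_juxt conjg1.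
Qed.

Lemma lspan_conjC (f g : symalg) : lspan conj_rel (f * g - g * f).
Proof.
rewrite [f]symalg_sum mulr_suml mulr_sumr -sumrB.
apply: lspan_sum => -[n s]; rewrite [g]symalg_sum.
rewrite [X in X - _]mulr_sumr [X in _ - X]mulr_suml -sumrB.
apply: lspan_sum => -[m t]; rewrite -!scalerAl !symalg_scaleAr /=.
rewrite scalerA mulrC -scalerA -scalerBr -scalerBr.
do 2!apply: lspanZ; apply: lspan_incl; rewrite !single_mul.
exists (m + n)%N, (juxt t s), (perm (@swap_inj m n)).
by rewrite /single juxtC.
Qed.

Definition KXone : KX := cls 1.
Definition KXmul (x y : KX) : KX := cls (repr x * repr y).
Definition KXscale (a : F) (x : KX) : KX := cls (a *: repr x).

Lemma cls_mulE f g : KXmul (cls f) (cls g) = cls (f * g).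
Proof.
have repr_cls h : lspan conj_rel (repr (cls h) - h).
  by apply/cls_eq; rewrite cls_repr.
apply/cls_eq; set f' := repr _; set g' := repr _.
have -> : f' * g' - f * g = (f' - f) * g' + f * (g' - g).
  by rewrite mulrBl mulrBr addrA subrK.
by apply: lspanD; [apply/lspan_conjMr/repr_cls|apply/lspan_conjMl/repr_cls].
Qed.

Lemma cls_scaleE a f : KXscale a (cls f) = cls (a *: f).
Proof.
by apply/cls_eq; rewrite -scalerBr; apply/lspanZ/cls_eq; rewrite cls_repr.
Qed.

Fact KXmulA : associative KXmul.
Proof.
move=> x y z; rewrite -[x]cls_repr -[y]cls_repr -[z]cls_repr.
by rewrite [KXmul (cls (repr y)) _]cls_mulE [KXmul (cls (repr x)) (cls (repr y))]cls_mulE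
  !cls_mulE mulrA.
Qed.
Fact KXmulC : commutative KXmul.
Proof.
move=> x y; rewrite -[x]cls_repr -[y]cls_repr !cls_mulE.
by apply/cls_eq/lspan_conjC.
Qed.
Fact KXmul1 : left_id KXone KXmul.
Proof. by move=> x; rewrite -[x]cls_repr cls_mulE mul1r. Qed.
Fact KXmulDl : left_distributive KXmul +%R.
Proof.
move=> x y z; rewrite -[x]cls_repr -[y]cls_repr -[z]cls_repr.
by rewrite -raddfD !cls_mulE -raddfD mulrDl.
Qed.

(* The sum of all coefficients vanishes on conj_rel but not at 1. *)
Lemma KXone_neq0 : KXone != 0.
Proof.
apply/eqP; rewrite -(raddf0 cls) => /cls_eq; rewrite subr0.
pose aug : symalg -> F := mmap idfun (fun _ => 1).
have augZ a f : aug (a *: f) = a * aug f.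
  rewrite /aug (mmapEw (msuppZ_le _ _)) mmapE mulr_sumr.
  by apply: eq_bigr => x _; rewrite mcoeffZ /= !mulr1.
move=> [r [rN /(congr1 aug)]].
rewrite /aug raddf_sum /= -/aug big_seq big1 => [|c /rN [n [s [t ->]]]].
  have -> : aug 1 = 1 by rewrite [LHS]mmapU mulr1.
  by move/eqP; rewrite oner_eq0.
by rewrite augZ /aug raddfB /= !mmapU subrr mulr0.
Qed.

HB.instance Definition _ := GRing.Zmodule_isComNzRing.Build KX
  KXmulA KXmulC KXmul1 KXmulDl KXone_neq0.

Fact KXscaleA a b v : KXscale a (KXscale b v) = KXscale (a * b) v.
Proof.
by rewrite -[v]cls_repr [KXscale b _]cls_scaleE !cls_scaleE scalerA.
Qed.
Fact KXscale1 : left_id 1 KXscale.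
Proof. by move=> v; rewrite -[v]cls_repr cls_scaleE scale1r. Qed.
Fact KXscaleDr : right_distributive KXscale +%R.
Proof.
move=> a u v; rewrite -[u]cls_repr -[v]cls_repr -raddfD !cls_scaleE.
by rewrite -raddfD scalerDr.
Qed.
Fact KXscaleDl v : {morph KXscale^~ v : a b / a + b}.
Proof.
by move=> a b; rewrite -[v]cls_repr !cls_scaleE -raddfD scalerDl.
Qed.
HB.instance Definition _ := GRing.Zmodule_isLmodule.Build F KX
  KXscaleA KXscale1 KXscaleDr KXscaleDl.

Fact KXscaleAl a (u v : KX) : a *: (u * v) = a *: u * v.
Proof.
have Zc f : a *: cls f = cls (a *: f) by apply: cls_scaleE.
have Mc f g : cls f * cls g = cls (f * g) by apply: cls_mulE.
by rewrite -[u]cls_repr -[v]cls_repr Mc !Zc Mc scalerAl.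
Qed.
HB.instance Definition _ := GRing.Lmodule_isLalgebra.Build F KX KXscaleAl.
HB.instance Definition _ := GRing.Lalgebra_isComAlgebra.Build F KX.

Fact cls_is_monoid_morphism : monoid_morphism cls.
Proof. by split=> // f g; apply/esym/cls_mulE. Qed.
HB.instance Definition _ :=
  GRing.isMonoidMorphism.Build symalg KX cls cls_is_monoid_morphism.
Fact cls_is_scalable : scalable cls.
Proof. by move=> a f; apply/esym/cls_scaleE. Qed.
HB.instance Definition _ :=
  GRing.isScalable.Build F symalg KX *:%R cls cls_is_scalable.

Lemma bar_mul n m (s : 'S_n) (t : 'S_m) : bar s * bar t = bar (juxt s t).
Proof. by rewrite /bar -rmorphM single_mul. Qed.

Lemma bar_conj n (s t : 'S_n) : bar (s ^ t)%g = bar s.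
Proof. by apply/cls_eq/lspan_incl; exists n, s, t. Qed.

(* Over an infinite field a polynomial on matrices is determined by its values,
   so Phi d x is taken as a function on 'M[F]_d; only its kernel is used. *)
Section Phi.
Variable d : nat.
Implicit Type T : 'M[F]_d.

(* The n-th tensor power of F^d has the basis e_f, the tensor product of the
   e_(f i), for f : {ffun 'I_n -> 'I_d}. Matrices act on columns, and Lperm s
   sends e_f to e_(f \o s^-1). *)
Definition tidx n (a : 'I_#|{ffun 'I_n -> 'I_d}|) : {ffun 'I_n -> 'I_d} :=
  enum_val a.

Definition tpow n T : 'M[F]_#|{ffun 'I_n -> 'I_d}| :=
  \matrix_(a, b) \prod_(i < n) T (tidx a i) (tidx b i).

Definition Lperm n (s : 'S_n) : 'M[F]_#|{ffun 'I_n -> 'I_d}| :=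
  \matrix_(a, b) (tidx a == [ffun i => tidx b (s^-1%g i)])%:R.

Definition trace_fun T (x : symperm) : F :=
  \tr (Lperm (tagged x) *m tpow (tag x) T).

Definition Phi (x : KX) T : F := mmap idfun (trace_fun T) (repr x).

Lemma trace_funE T n (s : 'S_n) : trace_fun T (Tagged (fun n => 'S_n) s) =
  \sum_(f : {ffun 'I_n -> 'I_d}) \prod_(i < n) T (f (s i)) (f i).
Proof.
have tidx_bij : bijective (@tidx n) by apply: enum_val_bij.
rewrite /trace_fun /mxtrace [RHS](reindex _ (onW_bij _ tidx_bij)) /=.
apply: eq_bigr => a _; rewrite mxE.
pose b : 'I_#|{ffun 'I_n -> 'I_d}| := enum_rank [ffun i => tidx a (s i)].
have bE : tidx b = [ffun i => tidx a (s i)] by rewrite /tidx enum_rankK.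
rewrite (bigD1 b) //= big1 ?addr0 => [|c cb]; rewrite !mxE.
  have -> : (tidx a == [ffun i => tidx b (s^-1%g i)]) = true.
    by apply/eqP/ffunP => i; rewrite bE !ffunE permKV.
  by rewrite mul1r bE; apply: eq_bigr => i _; rewrite ffunE.
case: eqP => [ac|]; last by rewrite mul0r.
case/eqP: cb; apply: (bij_inj tidx_bij); rewrite bE.
by apply/ffunP => i; rewrite ac !ffunE permK.
Qed.

Lemma trace_funJ T n (s t : 'S_n) :
  trace_fun T (Tagged (fun n => 'S_n) (s ^ t)%g) =
  trace_fun T (Tagged (fun n => 'S_n) s).
Proof.
pose h (f : {ffun 'I_n -> 'I_d}) : {ffun 'I_n -> 'I_d} := [ffun i => f (t^-1%g i)].
have hK : cancel h (fun f : {ffun 'I_n -> 'I_d} => [ffun i => f (t i)]).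
  by move=> f; apply/ffunP => i; rewrite !ffunE permK.
rewrite !trace_funE (reindex_inj (can_inj hK)); apply: eq_bigr => f _.
rewrite (reindex_inj (@perm_inj _ t)); apply: eq_bigr => i _.
by rewrite permJ !ffunE !permK.
Qed.

Lemma trace_fun_mmorphism T : mmorphism (trace_fun T).
Proof.
split=> [[n s] [m t]|]; last first.
  rewrite [LHS]trace_funE (eq_bigr (fun _ => 1)) => [|f _]; last by rewrite big_ord0.
  by rewrite sumr_const card_ffun !card_ord expn0.
rewrite [LHS]trace_funE !trace_funE big_distrlr pair_big /=.
pose h (f : {ffun 'I_n -> 'I_d} * {ffun 'I_m -> 'I_d}) : {ffun 'I_(n + m) -> 'I_d} :=
  [ffun i => match split i with inl j => f.1 j | inr k => f.2 k end].
have hl f i : h f (lshift m i) = f.1 i.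
  by rewrite ffunE -[lshift m i]/(unsplit (inl i)) unsplitK.
have hr f i : h f (rshift n i) = f.2 i.
  by rewrite ffunE -[rshift n i]/(unsplit (inr i)) unsplitK.
have h_bij : bijective h.
  exists (fun g : {ffun 'I_(n + m) -> 'I_d} =>
    ([ffun i => g (lshift m i)], [ffun i => g (rshift n i)])).
    by case=> f g; congr pair; apply/ffunP => i; rewrite ffunE (hl, hr).
  move=> g; apply/ffunP => i; rewrite -[i]splitK; case: (split i) => j.
    by rewrite hl ffunE.
  by rewrite hr ffunE.
rewrite (reindex _ (onW_bij _ h_bij)) /=; apply: eq_bigr => f _.
rewrite big_split_ord /=; congr (_ * _); apply: eq_bigr => i _.
  by rewrite juxtl !hl.
by rewrite juxtr !hr.
Qed.
HB.instance Definition _ T := isMultiplicative.Build symperm F (trace_fun T)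
  (trace_fun_mmorphism T).

Lemma Phi_cls f T : Phi (cls f) T = mmap idfun (trace_fun T) f.
Proof.
apply/eqP; rewrite -subr_eq0 /Phi -raddfB; apply/eqP.
have [r [rN ->]] : lspan conj_rel (repr (cls f) - f).
  by apply/cls_eq; rewrite cls_repr.
rewrite raddf_sum big_seq big1 // => c /rN [n [s [t ->]]].
by rewrite [LHS]mmapZ raddfB /= !mmapU trace_funJ subrr mulr0.
Qed.

Lemma Phi_bar n (s : 'S_n) T : Phi (bar s) T = \tr (Lperm s *m tpow n T).
Proof. by rewrite Phi_cls mmapU mul1r. Qed.

Lemma PhiD x y T : Phi (x + y) T = Phi x T + Phi y T.
Proof.
by rewrite -[x]cls_repr -[y]cls_repr -raddfD !Phi_cls raddfD.
Qed.
Lemma Phi0 T : Phi 0 T = 0.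
Proof. by rewrite -(raddf0 cls) Phi_cls raddf0. Qed.
Lemma PhiM x y T : Phi (x * y) T = Phi x T * Phi y T.
Proof.
by rewrite -[x]cls_repr -[y]cls_repr -rmorphM !Phi_cls rmorphM.
Qed.
Lemma Phi1 T : Phi 1 T = 1.
Proof. by rewrite [LHS]Phi_cls rmorph1. Qed.
Lemma PhiZ a x T : Phi (a *: x) T = a * Phi x T.
Proof. by rewrite -[x]cls_repr -(linearZ_LR cls) !Phi_cls [LHS]mmapZ. Qed.

Definition kerPhi : {pred KX} := fun x => `[< forall T, Phi x T = 0 >].

Fact kerPhi_idealr_closed : idealr_closed kerPhi.
Proof.
split=> [||a u v /asboolP u0 /asboolP v0]; first by apply/asboolP => T; apply: Phi0.
  by apply/asboolP => /(_ 0) /eqP; rewrite Phi1 oner_eq0.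
by apply/asboolP => T; rewrite PhiD PhiM u0 v0 mulr0 addr0.
Qed.
HB.instance Definition _ := isIdealr.Build KX kerPhi kerPhi_idealr_closed.
End Phi.
End KX.

Arguments kerPhi F d x : clear implicits.

Definition is_part (lam : seq nat) : bool := sorted geq lam && (0 \notin lam).

Definition conj_part (lam : seq nat) : seq nat :=
  mkseq (fun j => count (fun l => j < l)%N lam) (head 0%N lam).

Section Specht.
Variables (K : closedFieldType) (lam : seq nat).
Local Notation n := (sumn lam).
Local Notation G := [set: 'S_n]%G.

(* In the tableau that lists 0, ..., n - 1 row after row, i stands in row
   reshape_index lam i and in column reshape_offset lam i. *)
Definition row_stab : {set 'S_n} :=
  [set p : 'S_n | [forall i, reshape_index lam (p i) == reshape_index lam i]].
Definition col_stab : {set 'S_n} :=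
  [set q : 'S_n | [forall i, reshape_offset lam (q i) == reshape_offset lam i]].

Definition symReg := regular_repr K G.

(* The submodule of the regular module generated by the Young symmetrizer is
   the module spanned by the polytabloids. *)
Definition young_vec : 'rV[K]_#|G| :=
  \sum_(p in row_stab) \sum_(q in col_stab)
    (-1) ^+ q *: delta_mx 0 (gring_index G (p * q)%g).
Definition specht_mx := cyclic_mx symReg young_vec.
Definition specht : mx_representation K G (\rank specht_mx) :=
  submod_repr (cyclic_mx_module symReg young_vec).
Definition specht_dim := \rank specht_mx.

(* The central idempotent, as an endomorphism of the regular module; gring_row
   lists its coefficients in the group algebra. *)
Definition specht_idem : 'M[K]_#|G| :=
  Wedderburn_id (irr_comp (DecSocleType symReg) specht).

Definition specht_sum : symalg K :=
  \sum_(s : 'S_n) gring_row specht_idem 0 (gring_index G s) *: single K s.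

Definition sbr : KX K := specht_dim%:R^-1 *: cls specht_sum.
End Specht.

(* The partition with a single row, for n > 0. *)
Definition Xvar (K : closedFieldType) (n : nat) : KX K := sbr K [:: n].

Definition is_transposition (K : closedFieldType) (t : KX K -> KX K) : Prop :=
  linear t /\
  forall lam, is_part lam -> t (sbr K lam) = sbr K (conj_part lam).

(* In characteristic 0 the sbr K lam, for is_part lam, form a basis of KX K, so
   exactly one map is a transposition. *)
Definition transposition (K : closedFieldType) : KX K -> KX K :=
  if pselect (exists t, @is_transposition K t) is left h then projT1 (cid h)
  else fun=> 0.
Arguments transposition K x : clear implicits.

(* Main.v *)
(* The coinvariant ring KX has an involutive automorphism tsign, which multiplies
   the class of s by the sign of s.  If c = a b is the Young symmetrizer of lam (a the
   row sum, b the signed column sum) and c^2 = k c, then {lam} = k^-1 [c] in KX: the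
   sum of the conjugates of c is central in the block of the Specht module, hence a
   multiple of its idempotent.  Exchanging rows and columns, tsign {lam} = {lam^t};
   the {lam} span KX by a count of cycle types, so t = tsign.

   Put e_n = t(X_n).  The X_n, hence the e_n, generate KX, by triangularity against
   the cycles.  Phi_d(e_n) is the n-th coefficient of the characteristic polynomial:
   it vanishes for n > d, as a sum of determinants with a repeated row, and on diagonal
   matrices e_1, ..., e_d become the elementary symmetric polynomials, which are
   algebraically independent.  So I_d = (e_{d+1}, e_{d+2}, ...), and K[e_1, ..., e_d]
   is a complement of I_d. *)

Require Import Defs.
From HB Require Import structures.
From mathcomp Require Import all_boot all_order all_fingroup all_algebra.
From mathcomp Require Import pgroup all_character.
From mathcomp Require Import boolp.
From mathcomp Require Import finmap generic_quotient ring_quotient.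
From mathcomp Require monalg.
From mathcomp Require Import zify ring.
Set Implicit Arguments.
Unset Strict Implicit.
Unset Printing Implicit Defensive.
Import GRing.Theory.
Local Open Scope ring_scope.

(** * Coefficients in the group ring *)

(** In a full-rank factorization M = C R, cancelling C on the left and R on the right of C (R C) R =
    k C R gives R C = k, and R C has the trace of M. *)
Lemma mxtrace_quasi_idem (F : fieldType) n (M : 'M[F]_n) k :
  M *m M = k *: M -> \tr M = k * (\rank M)%:R.
Proof.
move=> MM; rewrite -{1}(mulmx_base M) mxtrace_mulC.
suff ->: row_base M *m col_base M = k%:M by rewrite mxtrace_scalar mulr_natr.
apply: (row_full_inj (col_base_full M)); apply: (row_free_inj (row_base_free M)).
rewrite mulmxA mulmx_base -mulmxA mulmx_base MM mul_mx_scalar -scalemxAl.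
by rewrite mulmx_base.
Qed.

Section GroupRing.
Variables (F : fieldType) (gT : finGroupType).
Local Notation G := [set: gT]%G.
Local Notation aG := (regular_repr F G).
Local Notation R_G := (group_ring F G).

(** [gring_row] reads a single row of the matrix, so this is defined for every [A], but it is a
    coefficient of [A] only when [A] lies in the group ring. *)
Definition gcoef (g : gT) (A : 'M[F]_#|G|) : F := gring_row A 0 (gring_index G g).

Fact gcoef_is_linear g : scalar (gcoef g).
Proof. by move=> a A B; rewrite /gcoef linearP !mxE. Qed.
HB.instance Definition _ g := GRing.isLinear.Build F _ F _ (gcoef g)
  (gcoef_is_linear g).

Lemma gcoefG g h : gcoef g (aG h) = (g == h)%:R.
Proof.
rewrite /gcoef /gring_row !mxE gring_indexK ?group1 // mul1g eqxx /=.
by rewrite (can_in_eq (@gring_indexK _ G)) ?in_setT.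
Qed.

Lemma regM g h : aG (g * h)%g = aG g *m aG h.
Proof. by rewrite repr_mxM ?in_setT. Qed.

Lemma memR_G g : (aG g \in R_G)%MS.
Proof. by rewrite envelop_mx_id ?in_setT. Qed.

Lemma gring_sum A : (A \in R_G)%MS -> A = \sum_g gcoef g A *: aG g.
Proof.
case/envelop_mxP=> a ->; apply: eq_big => [g|g _]; first by rewrite in_setT.
rewrite linear_sum /= (bigD1 g) ?in_setT //= linearZ /= gcoefG eqxx mulr1.
rewrite big1 ?addr0 // => h /andP[_ hg]; rewrite linearZ /= gcoefG eq_sym.
by rewrite (negPf hg) mulr0.
Qed.

Lemma gcoefMl g h A : (A \in R_G)%MS -> gcoef g (aG h *m A) = gcoef (h^-1 * g) A.
Proof.
move/gring_sum->; rewrite mulmx_sumr !linear_sum; apply: eq_bigr => k _.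
by rewrite -scalemxAr !linearZ /= -regM !gcoefG eq_sym (canF_eq (mulKg h)) eq_sym.
Qed.

Lemma gcoefMr g h A : (A \in R_G)%MS -> gcoef g (A *m aG h) = gcoef (g * h^-1) A.
Proof.
move/gring_sum->; rewrite mulmx_suml !linear_sum; apply: eq_bigr => k _.
by rewrite -scalemxAl !linearZ /= -regM !gcoefG eq_sym (canF_eq (mulgK h)) eq_sym.
Qed.

(** The coefficient at 1 acts as a trace on the group ring; by linearity one factor may be taken to
    be a group element. *)
Lemma gcoef1C A B : (A \in R_G)%MS -> (B \in R_G)%MS ->
  gcoef 1 (A *m B) = gcoef 1 (B *m A).
Proof.
move=> RA RB; rewrite (gring_sum RB) mulmx_sumr mulmx_suml !linear_sum /=.
apply: eq_bigr => g _; rewrite -scalemxAl -scalemxAr !linearZ /=.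
by rewrite gcoefMl // gcoefMr // mulg1 mul1g.
Qed.

Definition conj_sum A := \sum_g (aG g *m A *m aG g^-1%g).

Lemma memR_conj_sum A : (A \in R_G)%MS -> (conj_sum A \in R_G)%MS.
Proof.
by move=> RA; rewrite /conj_sum linear_sum summx_sub //= => g _; rewrite !envelop_mxM ?memR_G.
Qed.

Lemma conj_sumC A B : (B \in R_G)%MS -> conj_sum A *m B = B *m conj_sum A.
Proof.
move/gring_sum->; rewrite mulmx_sumr mulmx_suml; apply: eq_bigr => h _.
rewrite -scalemxAl -scalemxAr; congr (_ *: _).
rewrite mulmx_suml mulmx_sumr [RHS](reindex_inj (mulgI h^-1%g)) /=.
apply: eq_bigr => g _; rewrite !mulmxA -regM mulVKg -!mulmxA -regM invMg.
by rewrite invgK.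
Qed.

End GroupRing.
Arguments gcoef {F gT} g A.

(** * Elements c of the group ring with c K[G] c = K c *)

Lemma gring_op_submod (F : fieldType) (gT : finGroupType) (G : {group gT})
    n (rG : mx_representation F G n) (U : 'M_n) (modU : mxmodule rG U) A :
  (A \in group_ring F G)%MS ->
  gring_op (submod_repr modU) A =
    in_submod U (val_submod 1%:M *m gring_op rG A).
Proof.
case/envelop_mxP=> a ->; rewrite linear_sum [gring_op rG _]linear_sum mulmx_sumr linear_sum.
apply: eq_bigr => x Gx.
by rewrite linearZ /= [gring_op rG _]linearZ /= -scalemxAr linearZ /= !gring_opG.
Qed.

Section QuasiPrimitive.
Variables (K : closedFieldType) (gT : finGroupType).
Local Notation G := [set: gT]%G.
Local Notation aG := (regular_repr K G).
Local Notation R_G := (group_ring K G).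
Hypothesis nzG : #|gT|%:R != 0 :> K.
Variable c : 'M[K]_#|G|.
Hypothesis R_c : (c \in R_G)%MS.
Hypothesis c1 : gcoef 1 c = 1.
Hypothesis cGc : forall g, exists k, c *m aG g *m c = k *: c.

(** As [c] has coefficient 1 at the identity, this is the scalar by which [c A c] is a multiple of
    [c]; for A = 1 it is [kap]. *)
Definition qscal A := gcoef 1 (c *m A *m c).
Local Notation kap := (gcoef 1 (c *m c)).

Lemma qscalE A : (A \in R_G)%MS -> c *m A *m c = qscal A *: c.
Proof.
move/gring_sum->; rewrite /qscal mulmx_sumr mulmx_suml linear_sum scaler_suml.
apply: eq_bigr => g _; rewrite -scalemxAr -scalemxAl; have [k ->] := cGc g.
by rewrite scalerA !linearZ /= c1 mulr1.
Qed.

Lemma qsqr : c *m c = kap *: c.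
Proof. by have := qscalE (envelop_mx1 aG); rewrite /qscal mulmx1. Qed.

Local Notation U := (cyclic_mx aG (gring_row c)).

(* Both sides are the trace of left multiplication by [c] on the group ring. *)
Lemma rank_qprim : kap * (\rank U)%:R = #|gT|%:R.
Proof.
(* [L] is left multiplication by [c] in the coordinates of [gring_row]. Its row space is the right
   ideal generated by [c], and each diagonal entry is the coefficient of [c] at 1. *)
pose L := \matrix_(i < #|G|) gring_row (c *m aG (enum_val i)).
have LE A : (A \in R_G)%MS -> gring_row A *m L = gring_row (c *m A).
  move=> RA; rewrite [gring_row A]row_sum_delta mulmx_suml.
  rewrite {2}(gring_sum RA) mulmx_sumr linear_sum /=.
  have vb : bijective (@enum_val _ (mem G)).
    exists (gring_index G); [exact: gring_valK|].
    by move=> g; rewrite gring_indexK ?in_setT.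
  rewrite (reindex _ (onW_bij _ vb)) /=; apply: eq_bigr => i _.
  by rewrite -scalemxAl -scalemxAr linearZ /= -rowE rowK /gcoef gring_valK.
have LL : L *m L = kap *: L.
  apply/row_matrixP=> i; rewrite row_mul !rowK LE ?envelop_mxM ?memR_G //.
  by rewrite mulmxA [in LHS]qsqr -scalemxAl !linearZ /= rowK.
have UL : (U :=: L)%MS.
  apply/eqmxP/andP; split; last first.
    apply/row_subP=> i; rewrite rowK gring_row_mul.
    apply/cyclic_mxP; exists (aG (enum_val i)) => //; exact: memR_G.
  apply/row_subP=> i; apply: submx_trans (row_sub i _) _.
  apply/rV_subP => v /cyclic_mxP[A RA ->]; rewrite -gring_row_mul -LE //.
  exact: submxMl.
rewrite UL -(mxtrace_quasi_idem LL) /mxtrace.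
rewrite (eq_bigr (fun=> 1)) => [|i _]; first by rewrite sumr_const card_ord cardsT.
rewrite -[RHS]c1 -[X in gcoef X c](mulgV (enum_val i)) -gcoefMr //.
by rewrite /gcoef gring_valK mxE.
Qed.

Lemma kap_neq0 : kap != 0.
Proof. by apply: contraNneq nzG => k0; rewrite -rank_qprim k0 mul0r. Qed.

(* Both sides are the trace of [X |-> c X c] on the group ring. *)
Lemma gcoef_conj_sum_qprim : gcoef 1 (c *m conj_sum c) = kap ^+ 2.
Proof.
have -> : kap ^+ 2 = qscal c.
  have cc := qsqr; rewrite /qscal; set k := kap in cc *.
  by rewrite cc -scalemxAl linearZ.
rewrite /conj_sum mulmx_sumr linear_sum /= [in RHS](gring_sum R_c).
rewrite /qscal mulmx_sumr mulmx_suml linear_sum; apply: eq_bigr => g _.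
rewrite !mulmxA gcoefMr ?envelop_mxM ?memR_G // mul1g invgK.
rewrite qscalE ?memR_G // -scalemxAr -scalemxAl !linearZ /=.
by rewrite qscalE ?memR_G // linearZ /= c1 mulr1 mulrC.
Qed.

Let F'G : ([pchar K]^'.-group G)%g.
Proof.
by rewrite /pgroup cardsT pcharf'_nat.
Qed.

Local Notation sG := (DecSocleType aG).
Local Notation W := (irr_comp sG (submod_repr (cyclic_mx_module aG (gring_row c)))).

(** Both products lie in the two-sided ideal that has the idempotent as unit, so both equal the
    product with the idempotent on either side of [A]. *)
Lemma Wedderburn_idC i A : (A \in R_G)%MS ->
  Wedderburn_id i *m A = A *m Wedderburn_id (i : sG).
Proof.
have Re : (Wedderburn_id i \in R_G)%MS.
  rewrite -(Wedderburn_sum_pchar sG F'G); apply: (sumsmx_sup i) => //.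
  exact: Wedderburn_id_mem.
have [_ _ el er] := Wedderburn_is_id_pchar F'G i.
move=> RA; have /andP[il ir] := Wedderburn_ideal i.
transitivity (Wedderburn_id i *m A *m Wedderburn_id i).
  by rewrite er // (memmx_subP ir) // mem_mulsmx // Wedderburn_id_mem.
by rewrite -mulmxA el // (memmx_subP il) // mem_mulsmx // Wedderburn_id_mem.
Qed.

(** For a block idempotent e, [c e] is a multiple b c with b b = b, hence 0 or [c]. The block
    idempotents sum to 1, so some e does not kill [c]. A block acts nontrivially on the module
    generated by [c] exactly when its idempotent does not kill [c], and [irr_comp] picks such a
    block. *)
Lemma mulmx_qprim_irr_comp : c *m Wedderburn_id W = c.
Proof.
have Re (i : sG) : (Wedderburn_id i \in R_G)%MS.
  rewrite -(Wedderburn_sum_pchar sG F'G); apply: (sumsmx_sup i) => //.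
  exact: Wedderburn_id_mem.
have ee (i : sG) : Wedderburn_id i *m Wedderburn_id i = Wedderburn_id i.
  by case: (Wedderburn_is_id_pchar F'G i) => _ Ri -> //; apply: Ri.
have ceq (i : sG) : c *m Wedderburn_id i != 0 -> c *m Wedderburn_id i = c.
  move=> nz.
  have cE : kap *: (c *m Wedderburn_id i) = qscal (Wedderburn_id i) *: c.
    by rewrite -qscalE // -mulmxA Wedderburn_idC // mulmxA [in RHS]qsqr -scalemxAl.
  pose b := kap^-1 * qscal (Wedderburn_id i).
  have {}cE : c *m Wedderburn_id i = b *: c.
    by rewrite /b -scalerA -cE scalerA mulVf ?kap_neq0 ?scale1r.
  have : b *: (b *: c) = b *: c by rewrite -cE scalemxAl -cE -mulmxA ee.
  move/(congr1 (gcoef 1)); rewrite !linearZ /= c1 mulr1 => bb.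
  have b0 : b != 0 by apply: contraNneq nz => b0; rewrite cE b0 scale0r.
  by rewrite cE (mulfI b0 (etrans bb (esym (mulr1 b)))) scale1r.
have op0 (i : sG) :
  gring_op (submod_repr (cyclic_mx_module aG (gring_row c))) (Wedderburn_id i) = 0
    <-> c *m Wedderburn_id i = 0.
  rewrite gring_op_submod // gring_op_id //; split=> [e0|ce0].
    have : gring_row c *m Wedderburn_id i = 0.
      have /in_submodK <- : (gring_row c <= U)%MS by apply: cyclic_mx_id.
      rewrite val_submodE -mulmxA; set E := _ *m Wedderburn_id i in e0 *.
      suff -> : E = 0 by rewrite mulmx0.
      have EU : (E <= U)%MS.
        exact: (mxmodule_envelop (cyclic_mx_module aG (gring_row c)) _ (val_submodP _)).
      by rewrite -(in_submodK EU) e0 linear0.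
    rewrite -gring_row_mul => /(congr1 (gring_mx aG)).
    by rewrite linear0 gring_rowK // envelop_mxM.
  suff -> : (val_submod (1%:M : 'M_(\rank U)) *m Wedderburn_id i = 0) by rewrite linear0.
  apply/row_matrixP => j; rewrite row_mul row0.
  have /cyclic_mxP[A RA ->] : (row j (val_submod (1%:M : 'M_(\rank U))) <= U)%MS.
    by apply: submx_trans (row_sub _ _) (val_submodP _).
  rewrite -gring_row_mul -gring_row_mul -mulmxA -Wedderburn_idC // mulmxA ce0.
  by rewrite mul0mx linear0.
have [i ci0] : exists i : sG, c *m Wedderburn_id i != 0.
  apply/existsP; apply: contraT; rewrite negb_exists => /forallP c0.
  have := c1; rewrite -[c]mulmx1 -(Wedderburn_sum_id_pchar sG F'G) mulmx_sumr.
  rewrite big1 ?linear0 => [/eqP|i _]; first by rewrite eq_sym oner_eq0.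
  by have := c0 i; rewrite negbK => /eqP.
apply: ceq; rewrite /irr_comp; case: pickP => [j nz|/(_ i) /eqP/op0 ci] /=.
  by apply/eqP => /op0/eqP; rewrite (negPf nz).
by rewrite ci eqxx in ci0.
Qed.

(** The sum of conjugates is central and lies in the block [W], whose centre is the line through its
    idempotent because [K] is algebraically closed. The scalar comes from comparing coefficients at
    1 after multiplication by [c]. *)
Lemma conj_sum_qprim : conj_sum c = kap ^+ 2 *: Wedderburn_id W.
Proof.
have splitG : group_splitting_field K G := @group_closure_closed_field K gT G.
have cW := mulmx_qprim_irr_comp; set w := W in cW *.
have Rz := memR_conj_sum R_c.
have Re : (Wedderburn_id w \in R_G)%MS.
  rewrite -(Wedderburn_sum_pchar sG F'G); apply: (sumsmx_sup w) => //.
  exact: Wedderburn_id_mem.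
have zW : conj_sum c *m Wedderburn_id w = conj_sum c.
  rewrite mulmx_suml; apply: eq_bigr => g _.
  by rewrite -mulmxA -Wedderburn_idC ?memR_G // mulmxA -(mulmxA (aG g) c) cW.
have /sub_rVP[k zk] : (mxvec (conj_sum c) <= mxvec (Wedderburn_id w))%MS.
  rewrite -(Wedderburn_subring_center_pchar F'G splitG) sub_capmx.
  apply/andP; split; last first.
    apply/cent_mxP => A RA; apply/esym/conj_sumC.
    rewrite -(Wedderburn_sum_pchar sG F'G); apply: (sumsmx_sup w) => //.
  rewrite -zW; have /andP[idl _] := Wedderburn_ideal w.
  by apply: (memmx_subP idl); apply: mem_mulsmx => //; apply: Wedderburn_id_mem.
have {}zk : conj_sum c = k *: Wedderburn_id w.
  by apply: (can_inj mxvecK); rewrite zk linearZ.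
rewrite zk; congr (_ *: _).
by rewrite -gcoef_conj_sum_qprim zk -scalemxAr cW linearZ /= c1 mulr1.
Qed.
End QuasiPrimitive.

(** * Fillings *)

Section Fillings.
Variable T : finType.
Implicit Types (r k : T -> nat) (s : {perm T}).

(* [r] and [k] give the row and the column of each entry; rows are left-justified. *)
Definition tableau r k :=
  injective (fun x => (r x, k x)) /\
  forall x j, (j < k x)%N -> exists2 y, r y = r x & k y = j.

(** A row of a tableau fills an initial segment of columns. If row [i] reaches column [m], it has
    [m] entries in columns less than [m], and distinct values of [k'] cannot give more; otherwise
    all its entries are counted. *)
Lemma card_row_leq r k k' i m : tableau r k -> injective (fun x => (r x, k' x)) ->
  (#|[pred x | (r x == i) && (k' x < m)%N]|
     <= #|[pred x | (r x == i) && (k x < m)%N]|)%N.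
Proof.
move=> [injrk leftj] injk'.
have [/existsP[x /andP[/eqP rx kx]]|] := boolP [exists x, (r x == i) && (m <= k x)%N].
  apply: (@leq_trans m).
    pose f (x : T) : 'I_m.+1 := inord (k' x).
    have fE y : y \in [pred x | (r x == i) && (k' x < m)%N] -> f y = k' y :> nat.
      by move=> /andP[_ km]; rewrite inordK // ltnW.
    rewrite -(@card_in_image _ _ f) => [|y z Ay Az fyz]; last first.
      apply: injk'; rewrite -(fE _ Ay) -(fE _ Az) fyz; congr pair.
      by case/andP: Ay Az => /eqP-> _ /andP[/eqP->].
    apply: leq_trans (subset_leq_card (B := [pred j : 'I_m.+1 | j < m]%N) _) _.
      by apply/subsetP => _ /imageP[y Ay ->]; rewrite inE fE //; case/andP: Ay.
    rewrite -[leqRHS]card_ord -(@card_image _ _ (widen_ord (leqnSn m))).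
      apply/subset_leq_card/subsetP => j jm; apply/imageP.
      by exists (Ordinal jm) => //; apply: val_inj.
    by move=> a b /(congr1 val) ab; apply: val_inj.
  have ex (j : 'I_m) : exists y, (r y == i) && (k y == j :> nat).
    have [y ry ky] := leftj x j (leq_trans (ltn_ord j) kx).
    by exists y; rewrite ry rx ky !eqxx.
  pose f j := xchoose (ex j).
  have fP j : r (f j) = i /\ k (f j) = j by case/andP: (xchooseP (ex j)) => /eqP-> /eqP->.
  rewrite -[leqLHS]card_ord -(@card_image _ _ f) => [|a b fab].
    apply/subset_leq_card/subsetP => _ /imageP[j _ ->]; have [rf kf] := fP j.
    by rewrite inE rf eqxx kf ltn_ord.
  by apply: val_inj => /=; case: (fP a) (fP b) => _ <- [_ <-]; rewrite fab.
rewrite negb_exists => /forallP rowi; apply/subset_leq_card/subsetP => x.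
move=> /andP[rx _]; rewrite inE rx /=; have := rowi x.
by rewrite rx /= -ltnNge.
Qed.

Lemma card_rows r (P : pred T) :
  #|[pred x | P x]| =
  (\sum_(i < (\max_x r x).+1) #|[pred x | (r x == i) && P x]|)%N.
Proof.
rewrite -sum1_card.
rewrite (partition_big (fun x => inord (r x) : 'I_(\max_x r x).+1) predT) //=.
apply: eq_bigr => i _; rewrite -sum1_card; apply: eq_bigl => x; rewrite !inE andbC.
congr (_ && _); apply/eqP/eqP => [<-|rx]; first by rewrite inordK // ltnS leq_bigmax.
by apply: val_inj; rewrite /= inordK // ltnS leq_bigmax.
Qed.

Lemma card_below_leq r k k' m : tableau r k -> injective (fun x => (r x, k' x)) ->
  (#|[pred x | k' x < m]| <= #|[pred x | k x < m]|)%N.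
Proof.
move=> tab inj'; rewrite (card_rows r (fun x => k' x < m)%N).
by rewrite (card_rows r (fun x => k x < m)%N) leq_sum // => i _; apply: card_row_leq.
Qed.

(** The inequalities of [card_row_leq] have equal sums over the rows, so each is an equality.
    Subtracting the counts for two consecutive bounds shows that [k] takes the value [k' x] in the
    row of [x] as often as [k'] does, hence at least once. *)
Lemma tableau_cell r k k' x : tableau r k -> injective (fun x => (r x, k' x)) ->
  (forall m, #|[pred x | k' x < m]%N| = #|[pred x | k x < m]%N|) ->
  exists2 y, r y = r x & k y = k' x.
Proof.
move=> tab inj' eqC.
have eqR m : #|[pred y | (r y == r x) && (k' y < m)%N]| =
             #|[pred y | (r y == r x) && (k y < m)%N]|.
  have := eqC m; rewrite (card_rows r (fun x => k' x < m)%N).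
  rewrite (card_rows r (fun x => k x < m)%N) => /eqP.
  rewrite (bigD1 (inord (r x))) //= [in X in _ == X](bigD1 (inord (r x))) //=.
  rewrite inordK ?ltnS ?leq_bigmax // => /eqP eqS.
  apply/eqP; rewrite eqn_leq card_row_leq //= leqNgt; apply/negP => lt.
  have : (\sum_(i < (\max_x r x).+1 | i != inord (r x))
           #|[pred y | (r y == i) && (k' y < m)%N]| <=
         \sum_(i < (\max_x r x).+1 | i != inord (r x))
           #|[pred y | (r y == i) && (k y < m)%N]|)%N.
    by apply: leq_sum => i _; apply: card_row_leq.
  by rewrite -(leq_add2l #|[pred y | (r y == r x) && (k y < m)%N]|) -eqS leq_add2r leqNgt lt.
have split f m : #|[pred y | (r y == r x) && (f y < m.+1)%N]| =
    (#|[pred y | (r y == r x) && (f y < m)%N]| +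
     #|[pred y | (r y == r x) && (f y == m)]|)%N.
  rewrite -cardUI [X in (_ + X)%N]eq_card0 ?addn0 => [|y].
    by apply: eq_card => y; rewrite !inE ltnS leq_eqVlt; case: eqP => /= _; lia.
  by rewrite !inE; case: (r y == r x) => //=; lia.
have : #|[pred y | (r y == r x) && (k y == k' x)]| =
       #|[pred y | (r y == r x) && (k' y == k' x)]|.
  by apply: (@addnI #|[pred y | (r y == r x) && (k y < k' x)%N]|); rewrite -split -eqR split eqR.
move=> eqk; have : (0 < #|[pred y | (r y == r x) && (k y == k' x)]|)%N.
  by rewrite eqk; apply/card_gt0P; exists x; rewrite inE !eqxx.
by case/card_gt0P => y /andP[/eqP ry /eqP ky]; exists y.
Qed.
End Fillings.

(** * Young symmetrizers *)

Section YoungSymmetrizer.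
Variables (F : fieldType) (T : finType).
Hypothesis nz2 : 2%:R != 0 :> F.
Local Notation G := [set: {perm T}]%G.
Local Notation aG := (regular_repr F G).
Local Notation R_G := (group_ring F G).
Implicit Types (r k : T -> nat) (g s : {perm T}).

Definition stab r : {set {perm T}} := [set p : {perm T} | [forall x, r (p x) == r x]].
Definition sym r : 'M[F]_#|G| := \sum_(p in stab r) aG p.
Definition alt r : 'M[F]_#|G| := \sum_(p in stab r) (-1) ^+ p *: aG p.
Definition young r k := sym r *m alt k.

Lemma stabP r g : reflect (forall x, r (g x) = r x) (g \in stab r).
Proof. by rewrite /stab inE; apply: (iffP forallP) => h x; apply/eqP; rewrite h. Qed.

Lemma stabM r g s : g \in stab r -> (s * g \in stab r)%g = (s \in stab r).
Proof.
move=> /stabP rg; apply/stabP/stabP => rs x; last by rewrite permM rg.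
by have := rs x; rewrite permM rg.
Qed.

Lemma stabMl r g s : g \in stab r -> (g * s \in stab r)%g = (s \in stab r).
Proof.
move=> /stabP rg; apply/stabP/stabP => rs x; last by rewrite permM rs.
by rewrite -[in LHS](permKV g x) -permM rs -[in RHS](permKV g x) rg.
Qed.

Lemma stab1 r : 1%g \in stab r.
Proof. by apply/stabP => x; rewrite perm1. Qed.

Lemma stabV r g : g \in stab r -> g^-1%g \in stab r.
Proof. by move=> rg; rewrite -(stabM _ rg) mulVg stab1. Qed.

Lemma stab_tperm r x y : r x = r y -> tperm x y \in stab r.
Proof. by move=> rxy; apply/stabP => z; case: tpermP => // ->. Qed.

Lemma memR_sym r : (sym r \in R_G)%MS.
Proof. by rewrite linear_sum summx_sub // => p _; rewrite memR_G. Qed.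

Lemma memR_alt r : (alt r \in R_G)%MS.
Proof. by rewrite linear_sum summx_sub // => p _; rewrite linearZ scalemx_sub ?memR_G. Qed.

Lemma memR_young r k : (young r k \in R_G)%MS.
Proof. by rewrite envelop_mxM ?memR_sym ?memR_alt. Qed.

Lemma sym_reg r p : p \in stab r -> sym r *m aG p = sym r.
Proof.
move=> rp; rewrite mulmx_suml [RHS](reindex_inj (mulIg p)) /=.
by apply: eq_big => [s|s _]; rewrite ?stabM // regM.
Qed.

Lemma reg_sym r p : p \in stab r -> aG p *m sym r = sym r.
Proof.
move=> rp; rewrite mulmx_sumr [RHS](reindex_inj (mulgI p)) /=.
by apply: eq_big => [s|s _]; rewrite ?stabMl // regM.
Qed.

Lemma reg_alt r p : p \in stab r -> aG p *m alt r = (-1) ^+ p *: alt r.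
Proof.
move=> rp; rewrite mulmx_sumr scaler_sumr [RHS](reindex_inj (mulgI p)) /=.
apply: eq_big => [s|s _]; rewrite ?stabMl // -scalemxAr scalerA odd_permM regM.
by rewrite signr_addb mulrA -signr_addb addbb mul1r.
Qed.

Lemma alt_reg r p : p \in stab r -> alt r *m aG p = (-1) ^+ p *: alt r.
Proof.
move=> rp; rewrite mulmx_suml scaler_sumr [RHS](reindex_inj (mulIg p)) /=.
apply: eq_big => [s|s _]; rewrite ?stabM // -scalemxAl scalerA odd_permM regM.
by rewrite signr_addb mulrCA -signr_addb addbb mulr1.
Qed.

Lemma eq_opp_mx0 (X : 'M[F]_#|G|) : X = - X -> X = 0.
Proof.
move=> XN; apply/eqP; rewrite -(mulr0n X) -[X == _]orFb -(negPf nz2) -scaler_eq0.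
by rewrite scaler_nat mulr2n {1}XN addNr.
Qed.

Lemma not_injP (f : T -> nat * nat) :
  injective f \/ exists x y, x != y /\ f x = f y.
Proof.
have [/injectiveP|] := boolP (injectiveb f); first by left.
by move/injectivePn => [x [y xy fxy]]; right; exists x, y.
Qed.

(* Von Neumann's argument: [sym r] absorbs the transposition of two entries of one
   row of [r], and [alt k] turns its conjugate by [g] into the sign -1. *)
Lemma sym_reg_alt0 r k g : ~ injective (fun x => (r x, k (g x))) ->
  sym r *m aG g *m alt k = 0.
Proof.
move=> noinj; have [//|[x [y [xy [rxy kxy]]]]] := not_injP (fun x => (r x, k (g x))).
apply: eq_opp_mx0; rewrite -{1}(sym_reg (stab_tperm rxy)) -[X in X *m alt k]mulmxA.
rewrite -regM conjgC tpermJ regM mulmxA -[LHS]mulmxA reg_alt ?stab_tperm //.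
by rewrite odd_tperm (inj_eq perm_inj) xy scaleN1r mulmxN.
Qed.

Lemma alt_reg_sym0 r k g : ~ injective (fun x => (r x, k (g^-1%g x))) ->
  alt k *m aG g *m sym r = 0.
Proof.
move=> noinj; have [//|[x [y [xy [rxy kxy]]]]] := not_injP (fun x => (r x, k (g^-1%g x))).
apply: eq_opp_mx0; rewrite -{1}(reg_sym (stab_tperm rxy)) mulmxA -[X in X *m sym r]mulmxA.
rewrite -regM conjgCV tpermJ regM mulmxA alt_reg ?stab_tperm //.
by rewrite odd_tperm (inj_eq perm_inj) xy scaleN1r !mulNmx.
Qed.

(** On a tableau these are the partial sums of the column lengths, which define the dominance order
    of the transposed shapes. *)
Definition below k m := #|[pred x : T | k x < m]%N|.

Lemma below_perm k g m : below (k \o g) m = below k m.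
Proof.
rewrite /below -!sum1_card [RHS](reindex_inj (@perm_inj _ g)) /=.
by apply: eq_bigl => x; rewrite !inE.
Qed.

Lemma alt_reg_sym_below r k k' g m : tableau r k ->
  (below k m < below k' m)%N -> alt k' *m aG g *m sym r = 0.
Proof.
move=> tab lt; apply: alt_reg_sym0 => /(card_below_leq m tab) le.
have := leq_ltn_trans (le : below (k' \o g^-1%g) m <= below k m)%N lt.
by rewrite below_perm ltnn.
Qed.

(** If the product does not vanish for the reason in [sym_reg_alt0], then [tableau_cell] moves each
    [x] within its row to an entry in the column of [g x]. This is a row permutation p for which
    p^-1 g is a column permutation; the two symmetrizers absorb the factors of g = p (p^-1 g), up to
    sign. *)
Lemma sym_reg_alt r k g : tableau r k ->
  exists a, sym r *m aG g *m alt k = a *: young r k.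
Proof.
move=> tab; have [inj'|noinj] := not_injP (fun x => (r x, k (g x))); last first.
  exists 0; rewrite scale0r; apply: sym_reg_alt0 => inj'.
  by have [x [y [/eqP xy]]] := noinj; move/inj'.
have ex x : exists y, (r y == r x) && (k y == k (g x)).
  have [|y ry ky] := @tableau_cell _ r k (k \o g) x tab inj'.
    exact: below_perm.
  by exists y; rewrite ry ky !eqxx.
pose f x := xchoose (ex x).
have fP x : r (f x) = r x /\ k (f x) = k (g x).
  by case/andP: (xchooseP (ex x)) => /eqP-> /eqP->.
have f_inj : injective f.
  move=> x y fxy; apply: inj'.
  by case: (fP x) (fP y) => <- <- [<- <-]; rewrite fxy.
pose p := perm f_inj.
have rp : p \in stab r by apply/stabP => x; rewrite permE; case: (fP x).
have kq : (p^-1 * g)%g \in stab k.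
  apply/stabP => x; rewrite -[x in RHS](permKV p) permM.
  by rewrite [p _ in RHS]permE; case: (fP (p^-1%g x)).
exists ((-1) ^+ (p^-1 * g)%g); rewrite -[g in LHS](mulKVg p) regM.
by rewrite mulmxA sym_reg // -mulmxA reg_alt // -scalemxAr.
Qed.

Lemma young_reg_young r k g : tableau r k ->
  exists a, young r k *m aG g *m young r k = a *: young r k.
Proof.
move=> tab; set B := alt k *m aG g *m sym r.
have RB : (B \in R_G)%MS by rewrite !envelop_mxM ?memR_sym ?memR_alt ?memR_G.
have -> : young r k *m aG g *m young r k = sym r *m B *m alt k.
  by rewrite /young /B !mulmxA.
rewrite (gring_sum RB).
apply: (big_ind (fun X => exists a, sym r *m X *m alt k = a *: young r k)).
- by exists 0; rewrite mulmx0 mul0mx scale0r.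
- move=> X Y [a aE] [b bE]; exists (a + b).
  by rewrite mulmxDr mulmxDl aE bE scalerDl.
move=> h _; have [a aE] := sym_reg_alt h tab.
by exists (gcoef h B * a); rewrite -scalemxAr -scalemxAl aE scalerA.
Qed.

(** Only p = q = 1 contributes: if p q = 1, then p preserves the row and the column of every
    entry. *)
Lemma gcoef1_young r k : injective (fun x => (r x, k x)) -> gcoef 1 (young r k) = 1.
Proof.
move=> injrk; rewrite /young mulmx_suml linear_sum (bigD1 1%g) ?stab1 //=.
rewrite mulmx_sumr linear_sum (bigD1 1%g) ?stab1 //= odd_perm1 scale1r -regM.
rewrite gcoefG mulg1 eqxx big1 ?addr0 => [|q /andP[_ q1]]; last first.
  rewrite -scalemxAr -regM linearZ /= gcoefG mul1g.
  by rewrite eq_sym (negPf q1) mulr0.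
rewrite big1 ?addr0 // => p /andP[rp p1].
rewrite mulmx_sumr linear_sum big1 // => q kq.
rewrite -scalemxAr -regM linearZ /= gcoefG; case: eqP => [pq|]; last by rewrite mulr0.
case/eqP: p1; apply/permP => x; rewrite perm1; apply: injrk => /=.
move/stabP: rp => ->; congr pair.
have -> : p = q^-1%g by apply: (mulIg q); rewrite mulVg.
by move/stabV/stabP: kq => ->.
Qed.

(** Whichever filling has more entries in the first [m] columns, its column antisymmetrizer meets
    the row symmetrizer of the other filling in each term, directly or after a cyclic rotation under
    the coefficient at 1. That product is zero. *)
Lemma gcoef_young_conj_sum0 r k r' k' m : tableau r k -> tableau r' k' ->
  below k m != below k' m -> gcoef 1 (young r k *m conj_sum (young r' k')) = 0.
Proof.
move=> tab tab'; rewrite neq_ltn => lt.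
rewrite mulmx_sumr linear_sum big1 //= => g _; rewrite /young.
case/orP: lt => lt; last first.
  rewrite !mulmxA -(mulmxA (sym r) (alt k)) -(mulmxA (sym r)).
  by rewrite (alt_reg_sym_below g tab' lt) mulmx0 !mul0mx linear0.
rewrite -(mulmxA (sym r)) gcoef1C ?envelop_mxM ?memR_sym ?memR_alt ?memR_G //.
rewrite -!mulmxA (mulmxA (alt k')) (alt_reg_sym_below g^-1%g tab lt).
by rewrite !mulmx0 linear0.
Qed.

(** On the group ring this is the automorphism multiplying each permutation by its sign; other
    matrices are first replaced by the combination that [gcoef] reads off. *)
Definition sgn_twist (X : 'M[F]_#|G|) : 'M[F]_#|G| :=
  \sum_s gcoef s X *: ((-1) ^+ s *: aG s).

Fact sgn_twist_is_linear : linear sgn_twist.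
Proof.
move=> a X Y; rewrite /sgn_twist scaler_sumr -big_split; apply: eq_bigr => s _.
by rewrite linearP /= scalerDl -[(a * _) *: _]scalerA.
Qed.
HB.instance Definition _ := GRing.isLinear.Build F _ _ _ sgn_twist sgn_twist_is_linear.

Lemma sgn_twistG s : sgn_twist (aG s) = (-1) ^+ s *: aG s.
Proof.
rewrite /sgn_twist (bigD1 s) //= gcoefG eqxx scale1r big1 ?addr0 // => t ts.
by rewrite gcoefG (negPf ts) scale0r.
Qed.

Lemma sgn_twistM X Y : (X \in R_G)%MS -> (Y \in R_G)%MS ->
  sgn_twist (X *m Y) = sgn_twist X *m sgn_twist Y.
Proof.
move=> RX RY; have E Z : sgn_twist Z = \sum_s gcoef s Z *: ((-1) ^+ s *: aG s) by [].
rewrite {1}(gring_sum RX) {1}(gring_sum RY) mulmx_suml linear_sum [sgn_twist X]E.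
rewrite [RHS]mulmx_suml; apply: eq_bigr => s _.
rewrite mulmx_sumr linear_sum [sgn_twist Y]E [RHS]mulmx_sumr; apply: eq_bigr => t _.
rewrite -!scalemxAl -!scalemxAr -regM !linearZ /= sgn_twistG.
have AC (a b c d : F) : a * (b * (c * d)) = c * (b * (d * a)) by ring.
by rewrite odd_permM signr_addb !scalerA -!mulrA AC.
Qed.

Lemma gcoef1_sgn_twist X : gcoef 1 (sgn_twist X) = gcoef 1 X.
Proof.
rewrite /sgn_twist linear_sum (bigD1 1%g) //= odd_perm1 scale1r.
rewrite linearZ /= gcoefG eqxx mulr1 big1 ?addr0 // => s s1.
by rewrite !linearZ /= gcoefG eq_sym (negPf s1) !mulr0.
Qed.

Lemma sgn_twist_sym r : sgn_twist (sym r) = alt r.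
Proof. by rewrite /sym linear_sum; apply: eq_bigr => s _; rewrite /= sgn_twistG. Qed.

Lemma sgn_twist_alt r : sgn_twist (alt r) = sym r.
Proof.
rewrite /alt linear_sum; apply: eq_bigr => s _.
by rewrite linearZ /= sgn_twistG scalerA -signr_addb addbb scale1r.
Qed.

(** The sign twist exchanges [sym] and [alt] and keeps the coefficient at 1; a cyclic rotation then
    restores the order of the factors. *)
Lemma gcoef_young_sqr_swap r k :
  gcoef 1 (young r k *m young r k) = gcoef 1 (young k r *m young k r).
Proof.
rewrite -gcoef1_sgn_twist.
rewrite /young !sgn_twistM ?envelop_mxM ?memR_sym ?memR_alt //.
rewrite !sgn_twist_sym !sgn_twist_alt -!mulmxA gcoef1C ?envelop_mxM ?memR_sym ?memR_alt //.
by rewrite !mulmxA.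
Qed.

Lemma young_conj r k (w : {perm T}) :
  young (r \o w) (k \o w) = aG w *m young r k *m aG w^-1%g.
Proof.
have stJ f s : (s ^ w \in stab f)%g = (s \in stab (f \o w)).
  apply/stabP/stabP => h x; first by have := h (w x); rewrite permJ.
  by rewrite -[x](permKV w) permJ; apply: h.
have st f : sym (f \o w) *m aG w = aG w *m sym f.
  rewrite mulmx_suml mulmx_sumr [RHS](reindex_inj (@conjg_inj _ w)) /=.
  by apply: eq_big => [s|s _]; rewrite ?stJ // -!regM conjgC.
have al f : alt (f \o w) *m aG w = aG w *m alt f.
  rewrite mulmx_suml mulmx_sumr [RHS](reindex_inj (@conjg_inj _ w)) /=.
  apply: eq_big => [s|s _]; rewrite ?stJ // -scalemxAl -scalemxAr -!regM conjgC.
  by rewrite odd_permJ.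
rewrite /young mulmxA -st -(mulmxA (sym _)) -al mulmxA -[LHS]mulmx1.
by rewrite -(repr_mx1 aG) -(mulgV w) regM !mulmxA.
Qed.

End YoungSymmetrizer.

(** * Partitions *)

Section Partitions.
Implicit Types (lam mu : seq nat).

(** In a weakly decreasing list the entries larger than [j] form an initial segment. *)
Lemma nth_part lam i j : sorted geq lam ->
  (j < nth 0 lam i)%N = (i < count (fun l => j < l) lam)%N.
Proof.
elim: lam i => [|l lam IH] i /=; first by rewrite nth_nil.
move=> pl; have {}IH := IH ^~ (path_sorted pl).
have [jl|lj] := ltnP j l; first by case: i => [|i] //=; rewrite IH.
have c0 : count (fun l => j < l)%N lam = 0.
  apply/eqP; rewrite -leqn0 leqNgt -has_count; apply/hasPn => m ml.
  have geq_tr : transitive geq by move=> b a c ab bc; apply: leq_trans bc ab.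
  have /allP/(_ m ml) := order_path_min geq_tr pl.
  by rewrite /= -leqNgt => /leq_trans; apply.
by rewrite c0; case: i => [|i] /=; [rewrite ltnNge lj | rewrite IH c0].
Qed.

Lemma nth_conj_part lam j : sorted geq lam ->
  nth 0 (conj_part lam) j = count (fun l => j < l)%N lam.
Proof.
move=> slam; have [jh|hj] := ltnP j (head 0 lam); first by rewrite nth_mkseq.
rewrite nth_default ?size_mkseq //; apply/esym/eqP.
by rewrite -leqn0 leqNgt -nth_part // nth0 -leqNgt.
Qed.

Lemma conj_part_cell lam i j : sorted geq lam ->
  (j < nth 0 lam i)%N = (i < nth 0 (conj_part lam) j)%N.
Proof. by move=> slam; rewrite nth_conj_part // nth_part. Qed.

Definition rowf lam (x : 'I_(sumn lam)) : nat := reshape_index lam x.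
Definition colf lam (x : 'I_(sumn lam)) : nat := reshape_offset lam x.

Lemma rowcol_inj lam : injective (fun x => (@rowf lam x, @colf lam x)).
Proof.
move=> x y [rxy kxy]; apply: val_inj => /=.
by rewrite -(reshape_indexK lam x) -(reshape_indexK lam y) -/(rowf x) rxy -/(colf x) kxy.
Qed.

Lemma cell_colf lam (x : 'I_(sumn lam)) : (colf x < nth 0 lam (rowf x))%N.
Proof. exact: reshape_offsetP. Qed.

Lemma cell_ex lam i j : (j < nth 0 lam i)%N ->
  exists x : 'I_(sumn lam), rowf x = i /\ colf x = j.
Proof.
move=> ij; exists (Ordinal (flatten_indexP ij)).
by rewrite /rowf /colf flatten_indexKl // flatten_indexKr.
Qed.

Lemma tableau_part lam : tableau (@rowf lam) (@colf lam).
Proof.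
split=> [|x j jx]; first exact: rowcol_inj.
by have [y [ry ky]] := cell_ex (ltn_trans jx (cell_colf x)); exists y.
Qed.

Lemma card_col lam j :
  #|[pred x : 'I_(sumn lam) | colf x == j]| = count (fun l => j < l)%N lam.
Proof.
have -> : count (fun l => j < l)%N lam = #|[pred i : 'I_(size lam) | j < nth 0 lam i]%N|.
  rewrite -sum1_count (big_nth 0) big_mkord -sum1_card.
  by apply: eq_bigl => i; rewrite inE.
pose f (x : 'I_(sumn lam)) := Ordinal (reshape_indexP (ltn_ord x)).
rewrite -(card_in_image (f := f)) => [|x y]; last first.
  rewrite !inE => /eqP kx /eqP ky /(congr1 val) /= rxy.
  by apply: rowcol_inj; rewrite kx ky /rowf rxy.
apply: eq_card => i; rewrite !inE; apply/imageP/idP => [[x]|ij].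
  by rewrite inE => /eqP <- -> /=; apply: cell_colf.
have [x [rx kx]] := cell_ex ij; exists x; first by rewrite inE kx.
by apply: val_inj.
Qed.

Lemma below_colS lam m :
  below (@colf lam) m.+1 = (below (@colf lam) m + count (fun l => m < l)%N lam)%N.
Proof.
rewrite -card_col -cardUI [X in (_ + X)%N]eq_card0 ?addn0 => [|y].
  by apply: eq_card => y; rewrite !inE ltnS leq_eqVlt orbC.
by rewrite !inE; case: eqP => [->|]; rewrite ?ltnn ?andbF.
Qed.

(** Consecutive differences of [below] are the column lengths, which determine the rows. As no part
    is zero, the number of rows is the length of the first column. *)
Lemma part_below_inj lam mu : is_part lam -> is_part mu ->
  (forall m, below (@colf lam) m = below (@colf mu) m) -> lam = mu.
Proof.
move=> /andP[slam lam0] /andP[smu mu0] eqb.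
have eqc j : count (fun l => j < l)%N lam = count (fun l => j < l)%N mu.
  by apply: (@addnI (below (@colf lam) j)); rewrite -below_colS eqb eqb below_colS.
have sz nu : 0%N \notin nu -> size nu = count (fun l => 0 < l)%N nu.
  move=> nu0; apply/esym/eqP; rewrite -all_count; apply/allP => l ln.
  by rewrite lt0n; apply: contraNneq nu0 => <-.
apply: (@eq_from_nth _ 0%N) => [|i _]; first by rewrite !sz.
apply/eqP; rewrite eqn_leq; apply/andP; split; rewrite leqNgt; apply/negP.
  by rewrite nth_part // eqc -nth_part // ltnn.
by rewrite nth_part // -eqc -nth_part // ltnn.
Qed.

(** This is the reflection of the diagram in its diagonal. Cells are matched by their coordinates,
    so the equality of the two sizes is a consequence. *)
Lemma conj_tableau lam : sorted geq lam ->
  exists w : 'I_(sumn lam) -> 'I_(sumn (conj_part lam)),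
    [/\ bijective w, forall x, rowf (w x) = colf x & forall x, colf (w x) = rowf x].
Proof.
move=> slam; have cell := fun i j => conj_part_cell i j slam.
set mu := conj_part lam in cell *.
have exw (x : 'I_(sumn lam)) : exists y : 'I_(sumn mu),
    (rowf y == colf x) && (colf y == rowf x).
  have := cell_colf x; rewrite cell => /cell_ex [y [ry ky]].
  by exists y; rewrite ry ky !eqxx.
have exv (y : 'I_(sumn mu)) : exists x : 'I_(sumn lam),
    (rowf x == colf y) && (colf x == rowf y).
  have := cell_colf y; rewrite -cell => /cell_ex [x [rx kx]].
  by exists x; rewrite rx kx !eqxx.
exists (fun x => xchoose (exw x)); split=> [|x|x].
- exists (fun y => xchoose (exv y)) => x; apply: rowcol_inj.
    by case/andP: (xchooseP (exv (xchoose (exw x)))) => /eqP-> /eqP->;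
       case/andP: (xchooseP (exw x)) => /eqP-> /eqP->.
  by case/andP: (xchooseP (exw (xchoose (exv x)))) => /eqP-> /eqP->;
     case/andP: (xchooseP (exv x)) => /eqP-> /eqP->.
- by case/andP: (xchooseP (exw x)) => /eqP.
- by case/andP: (xchooseP (exw x)) => _ /eqP.
Qed.
End Partitions.

(** * Linear maps on KX and the sign twist *)

Section ClassFunctions.
Variables (F : fieldType) (V : lmodType F).

(** The linear extension of [h] from the basis of permutations, as a plain sum over the support
    since [V] is only a module. *)
Definition malg_lin (h : symperm -> V) (f : symalg F) : V :=
  \sum_(x <- monalg.msupp f) monalg.mcoeff x f *: h x.

Lemma malg_linw h (D : {fset symperm}) (f : symalg F) : (monalg.msupp f `<=` D)%fset ->
  malg_lin h f = \sum_(x <- D) monalg.mcoeff x f *: h x.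
Proof.
move=> le; rewrite /malg_lin (big_fset_incl _ le) // => x _ /monalg.mcoeff_outdom ->.
by rewrite scale0r.
Qed.

Fact malg_lin_is_linear h : linear (malg_lin h).
Proof.
move=> a f g.
pose D := (monalg.msupp (a *: f + g) `|` (monalg.msupp f `|` monalg.msupp g))%fset.
rewrite (@malg_linw h D (a *: f + g)) ?fsubsetUl //.
rewrite (@malg_linw h D f); last by rewrite fsubsetU // fsubsetUl orbT.
rewrite (@malg_linw h D g); last by rewrite fsubsetU // fsubsetUr orbT.
rewrite scaler_sumr -big_split; apply: eq_bigr => x _ /=.
by rewrite monalg.mcoeffD monalg.mcoeffZ scalerDl scalerA.
Qed.
HB.instance Definition _ h :=
  GRing.isLinear.Build F (symalg F) V *:%R (malg_lin h) (malg_lin_is_linear h).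

Lemma malg_lin_single h n (s : 'S_n) : malg_lin h (single F s) = h (Tagged (fun n => 'S_n) s).
Proof. by rewrite /malg_lin /single monalg.msuppU1 big_seq_fset1 monalg.mcoeffUU scale1r. Qed.

(** The value on a chosen representative; it does not depend on the choice once [h] is constant on
    conjugacy classes. *)
Definition KXlift h (x : KX F) : V := malg_lin h (repr x).

Variable h : symperm -> V.
Hypothesis hJ : forall n (s t : 'S_n),
  h (Tagged (fun n => 'S_n) (s ^ t)%g) = h (Tagged (fun n => 'S_n) s).

Lemma KXlift_cls f : KXlift h (cls f) = malg_lin h f.
Proof.
apply/eqP; rewrite -subr_eq0 /KXlift -raddfB; apply/eqP.
have [r [rN ->]] : lspan (@conj_rel F) (repr (cls f) - f).
  by apply/cls_eq; rewrite cls_repr.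
rewrite raddf_sum big_seq big1 //= => c /rN [n [s [t ->]]].
rewrite -[LHS]/(malg_lin h (c.1 *: (single F (s ^ t)%g - single F s))).
by rewrite linearZ linearB /= !malg_lin_single hJ subrr scaler0.
Qed.

Lemma KXlift_linear : linear (KXlift h).
Proof.
by move=> a x y; rewrite -[x]cls_repr -[y]cls_repr -linearP !KXlift_cls linearP.
Qed.

Lemma KXlift_bar n (s : 'S_n) : KXlift h (bar F s) = h (Tagged (fun n => 'S_n) s).
Proof. by rewrite /bar KXlift_cls malg_lin_single. Qed.
End ClassFunctions.

Lemma KX_bar_ind (F : fieldType) (P : KX F -> Prop) :
  P 0 -> (forall a x y, P x -> P y -> P (a *: x + y)) ->
  (forall n (s : 'S_n), P (bar F s)) -> forall x, P x.
Proof.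
move=> P0 PD Pbar x; rewrite -[x]cls_repr [repr x]symalg_sum linear_sum.
apply: (big_ind P) => // [u v Pu Pv|y _]; first by rewrite -[u]scale1r; apply: PD.
by rewrite linearZ /= -[_ *: _]addr0; apply: PD => //; apply: Pbar.
Qed.

Section SignTwist.
Variable F : fieldType.

Definition signbar (x : symperm) : KX F := (-1) ^+ tagged x *: bar F (tagged x).
Definition tsign : KX F -> KX F := KXlift signbar.

Lemma signbarJ n (s t : 'S_n) :
  signbar (Tagged (fun n => 'S_n) (s ^ t)%g) = signbar (Tagged (fun n => 'S_n) s).
Proof. by rewrite /signbar /= odd_permJ bar_conj. Qed.

HB.instance Definition _ := GRing.isLinear.Build F (KX F) (KX F) *:%R tsign
  (KXlift_linear signbarJ).

Lemma tsign_bar n (s : 'S_n) : tsign (bar F s) = (-1) ^+ s *: bar F s.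
Proof. exact: KXlift_bar signbarJ _ _. Qed.

Lemma tsignK : involutive tsign.
Proof.
apply: KX_bar_ind => [|a x y tx ty|n s]; first by rewrite !linear0.
  by rewrite !linearP /= tx ty.
by rewrite tsign_bar linearZ /= tsign_bar scalerA -signr_addb addbb scale1r.
Qed.

(** The sign is the determinant of the permutation matrix, and juxtaposition makes that matrix block
    diagonal. *)
Lemma sign_juxt n m (s : 'S_n) (t : 'S_m) :
  (-1) ^+ juxt s t = (-1) ^+ s * (-1) ^+ t :> F.
Proof.
rewrite -!det_perm -(@det_ublock _ _ _ _ 0); congr (\det _); apply/matrixP => i j.
rewrite -[i]splitK -[j]splitK; case: (split i) => a; case: (split j) => b /=.
- by rewrite block_mxEul !mxE juxtl (inj_eq (@lshift_inj _ _)).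
- by rewrite block_mxEur !mxE juxtl eq_lrshift.
- by rewrite block_mxEdl !mxE juxtr eq_rlshift.
- by rewrite block_mxEdr !mxE juxtr (inj_eq (@rshift_inj _ _)).
Qed.

Lemma tsignM : {morph tsign : x y / x * y}.
Proof.
move=> x y; elim/KX_bar_ind: x => [|a x x' tx tx'|n s].
- by rewrite linear0 !mul0r linear0.
- by rewrite linearP /= mulrDl -scalerAl linearP /= tx tx' mulrDl -scalerAl.
elim/KX_bar_ind: y => [|a x x' tx tx'|m t].
- by rewrite linear0 !mulr0 linear0.
- by rewrite linearP /= mulrDr -scalerAr linearP /= tx tx' mulrDr -scalerAr.
rewrite bar_mul !tsign_bar -scalerAl -scalerAr scalerA bar_mul.
by rewrite sign_juxt.
Qed.

Lemma tsign1 : tsign 1 = 1.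
Proof.
have -> : 1 = bar F (1%g : 'S_0) by [].
by rewrite tsign_bar odd_perm1 scale1r.
Qed.

HB.instance Definition _ := GRing.isMonoidMorphism.Build (KX F) (KX F) tsign
  (conj tsign1 tsignM).
End SignTwist.

(** * Classes in [KX] of elements of the group ring *)

Section GroupRingClass.
Variables (F : fieldType) (n : nat).
Local Notation G := [set: 'S_n]%G.
Local Notation aG := (regular_repr F G).
Local Notation R_G := (group_ring F G).

Definition barm (X : 'M[F]_#|G|) : KX F := \sum_(s : 'S_n) gcoef s X *: bar F s.

Fact barm_is_linear : linear barm.
Proof.
move=> a X Y; rewrite scaler_sumr -big_split; apply: eq_bigr => s _ /=.
by rewrite linearP /= scalerDl -[(a * _) *: _]scalerA.
Qed.
HB.instance Definition _ := GRing.isLinear.Build F _ (KX F) *:%R barm barm_is_linear.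

Lemma barmG s : barm (aG s) = bar F s.
Proof.
rewrite /barm (bigD1 s) //= gcoefG eqxx scale1r big1 ?addr0 // => t ts.
by rewrite gcoefG (negPf ts) scale0r.
Qed.

Lemma barmJ X g : (X \in R_G)%MS -> barm (aG g *m X *m aG g^-1%g) = barm X.
Proof.
move=> RX; rewrite /barm [RHS](reindex_inj (@conjg_inj _ g)) /=; apply: eq_bigr => s _.
rewrite bar_conj gcoefMr ?envelop_mxM ?memR_G // gcoefMl //.
by rewrite invgK conjgE mulgA.
Qed.

Lemma barm_conj_sum X : (X \in R_G)%MS -> barm (conj_sum X) = n`!%:R *: barm X.
Proof.
move=> RX; rewrite linear_sum /= (eq_bigr (fun=> barm X)) => [|g _].
  by rewrite sumr_const card_Sn scaler_nat.
exact: barmJ.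
Qed.

Lemma tsign_barm X : tsign (barm X) = barm (sgn_twist X).
Proof.
rewrite /barm /sgn_twist !linear_sum; apply: eq_bigr => s _.
rewrite !linearZ /= tsign_bar linear_sum (bigD1 s) //= big1 => [|t ts].
  by rewrite addr0 !linearZ /= gcoefG eqxx mulr1 scalerA mulrC.
by rewrite !linearZ /= gcoefG eq_sym (negPf ts) !mulr0.
Qed.

(** For a permutation g, the product g Y is the conjugate of Y g by g, and [KX] does not distinguish
    conjugates. *)
Lemma barmC X Y : (X \in R_G)%MS -> (Y \in R_G)%MS -> barm (X *m Y) = barm (Y *m X).
Proof.
move=> RX RY; rewrite (gring_sum RX) mulmx_suml mulmx_sumr !linear_sum /=.
apply: eq_bigr => g _; rewrite -scalemxAl -scalemxAr !linearZ /=; congr (_ *: _).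
rewrite -[RHS](barmJ g) ?envelop_mxM ?memR_G //.
by rewrite !mulmxA -mulmxA -regM mulgV repr_mx1 mulmx1.
Qed.

Lemma tsign_young r k : tsign (barm (young F r k)) = barm (young F k r).
Proof.
rewrite tsign_barm /young (sgn_twistM (memR_sym F r) (memR_alt F k)).
by rewrite sgn_twist_sym sgn_twist_alt (barmC (memR_alt F r) (memR_sym F k)).
Qed.

Lemma barm_young_perm r k (w : 'S_n) :
  barm (young F (r \o w) (k \o w)) = barm (young F r k).
Proof. by rewrite young_conj barmJ // memR_young. Qed.

Lemma gcoef_young_sqr_perm r k (w : 'S_n) :
  gcoef 1 (young F (r \o w) (k \o w) *m young F (r \o w) (k \o w)) =
  gcoef 1 (young F r k *m young F r k).
Proof.
have Ry := memR_young F r k; rewrite young_conj; set Y := young F r k in Ry *.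
have -> : aG w *m Y *m aG w^-1%g *m (aG w *m Y *m aG w^-1%g) =
          aG w *m (Y *m Y) *m aG w^-1%g.
  by rewrite !mulmxA -(mulmxA _ (aG w^-1%g)) -regM mulVg repr_mx1 mulmx1.
have RYY : (Y *m Y \in R_G)%MS by apply: envelop_mxM.
by rewrite gcoefMr ?gcoefMl ?(envelop_mxM (memR_G F w)) // mul1g invgK mulVg.
Qed.
End GroupRingClass.

(** * The elements {lambda} *)

(** The bijection forces n = m; after this identification [w] is a permutation, and the two
    symmetrizers are conjugate under it. *)
Lemma young_transport (F : fieldType) n m (r k : 'I_n -> nat) (r' k' : 'I_m -> nat)
    (w : 'I_n -> 'I_m) : bijective w ->
  (forall x, r' (w x) = r x) -> (forall x, k' (w x) = k x) ->
  barm (young F r k) = barm (young F r' k') /\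
  gcoef 1 (young F r k *m young F r k) = gcoef 1 (young F r' k' *m young F r' k').
Proof.
move=> bw; have nm : n = m by have := bij_eq_card bw; rewrite !card_ord.
case: m / nm r' k' w bw => r' k' w bw rw kw.
have -> : r = r' \o perm (bij_inj bw) by apply: funext => x; rewrite /= permE rw.
have -> : k = k' \o perm (bij_inj bw) by apply: funext => x; rewrite /= permE kw.
by rewrite barm_young_perm gcoef_young_sqr_perm.
Qed.

Section SpechtBasis.
Variable K : closedFieldType.
Hypothesis charK : [pchar K] =i pred0.

Lemma natK_neq0 n : (0 < n)%N -> n%:R != 0 :> K.
Proof. by rewrite lt0n ((pcharf0P K).1 charK). Qed.

(** In [KX] the n! conjugates of [c] agree, so n! [c] = a^2 [E]; dividing by n! = a d gives the
    claim. It is applied with [a] the scalar in c c = a c and [d] the dimension of the Specht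
    module. *)
Lemma normalized_idem n (c E : 'M[K]_#|[set: 'S_n]%G|) (a d : K) :
  (c \in group_ring K [set: 'S_n]%G)%MS -> a != 0 -> #|'S_n|%:R != 0 :> K ->
  a * d = #|'S_n|%:R -> conj_sum c = a ^+ 2 *: E ->
  d^-1 *: barm E = a^-1 *: barm c.
Proof.
move=> Rc a0 nz dE cE; have : barm (conj_sum c) = a ^+ 2 *: barm E.
  by rewrite cE; apply: linearZ.
rewrite (barm_conj_sum Rc).
rewrite -card_Sn -dE => /esym /(canRL (scalerK (expf_neq0 2 a0))) ->.
have d0 : d != 0 by apply: contraNneq nz => d0; rewrite -dE d0 mulr0.
by rewrite !scalerA; congr (_ *: _); field; rewrite a0 d0.
Qed.

Local Notation yng lam := (young K (@rowf lam) (@colf lam)).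
Definition ycoef lam : K := gcoef 1 (yng lam *m yng lam).

Lemma young_vecE lam : young_vec K lam = gring_row (yng lam).
Proof.
rewrite /young_vec /young mulmx_suml linear_sum.
apply: eq_big => [p|p _]; first by rewrite !inE.
rewrite mulmx_sumr linear_sum; apply: eq_big => [q|q _]; first by rewrite !inE.
rewrite -scalemxAr -regM linearZ /=; congr (_ *: _).
by rewrite /gring_row rowK gring_indexK ?group1 // mul1g.
Qed.

Lemma ycoef_neq0 lam : ycoef lam != 0.
Proof.
apply: kap_neq0 (memR_young _ _ _) _ _; rewrite ?card_Sn.
- exact/natK_neq0/fact_gt0.
- exact/gcoef1_young/rowcol_inj.
- by move=> g; apply: young_reg_young; [exact: natK_neq0 | exact: tableau_part].
Qed.

Lemma sbr_young lam : sbr K lam = (ycoef lam)^-1 *: barm (yng lam).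
Proof.
have nzG : #|{perm 'I_(sumn lam)}|%:R != 0 :> K.
  by rewrite card_Sn; apply/natK_neq0/fact_gt0.
have Rc := memR_young K (@rowf lam) (@colf lam).
have c1 : gcoef 1 (yng lam) = 1 by apply/gcoef1_young/rowcol_inj.
have cGc g : exists a, yng lam *m regular_repr K [set: 'S_(sumn lam)]%G g *m yng lam
    = a *: yng lam.
  by apply: young_reg_young; [exact: natK_neq0 | exact: tableau_part].
have dimE := rank_qprim Rc c1 cGc.
have idE := conj_sum_qprim nzG Rc c1 cGc.
have k0 := ycoef_neq0 lam.
have specht_sumE : cls (specht_sum K lam) = barm (specht_idem K lam).
  by rewrite /specht_sum linear_sum; apply: eq_bigr => s _; rewrite linearZ.
rewrite /sbr specht_sumE /specht_dim /specht_idem /specht /specht_mx young_vecE.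
exact: normalized_idem Rc k0 nzG dimE idE.
Qed.

Lemma tsign_sbr lam : sorted geq lam -> tsign (sbr K lam) = sbr K (conj_part lam).
Proof.
move=> slam; have [w [bw rw kw]] := conj_tableau slam.
rewrite !sbr_young linearZ /= tsign_young.
have [-> sqE] := @young_transport K _ _ (@colf lam) (@rowf lam) _ _ w bw rw kw.
by rewrite /ycoef gcoef_young_sqr_swap sqE.
Qed.

Lemma young_row n :
  young K (fun=> 0%N) (@nat_of_ord n) = \sum_(s : 'S_n) regular_repr K [set: 'S_n]%G s.
Proof.
rewrite /young /alt (big_pred1 1%g) => [|q /=].
  rewrite odd_perm1 scale1r repr_mx1 mulmx1; apply: eq_bigl => s.
  by apply/stabP.
apply/stabP/eqP => [q1|-> x]; last by rewrite perm1.
by apply/permP => x; apply: val_inj; rewrite perm1 /= q1.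
Qed.

Lemma Xvar_sum n : Xvar K n = n`!%:R^-1 *: \sum_(s : 'S_n) bar K s.
Proof.
(* [sumn [:: n]] computes to [n + 0] only, hence the casts. *)
have n0 : n = sumn [:: n] by rewrite /= addn0.
have col x : @colf [:: n] (cast_ord n0 x) = x.
  have := reshape_indexK [:: n] x; have := reshape_indexP (ltn_ord (cast_ord n0 x)).
  by rewrite /colf /= ltnS leqn0 => /eqP ->; rewrite /flatten_index /= add0n.
have row x : @rowf [:: n] (cast_ord n0 x) = 0%N.
  by have := reshape_indexP (ltn_ord (cast_ord n0 x)); rewrite /= ltnS leqn0 => /eqP.
have bc : bijective (cast_ord n0).
  by exists (cast_ord (esym n0)); [exact: cast_ordK | exact: cast_ordKV].
rewrite /Xvar sbr_young /ycoef.
have [<- <-] := @young_transport K _ _ (fun=> 0%N) (@nat_of_ord n) _ _ _ bc row col.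
rewrite young_row; congr (_^-1 *: _).
  (* The square of the sum of all permutations has coefficient n! at 1, since each permutation pairs
     with its inverse. *)
  rewrite mulmx_suml linear_sum -card_Sn -sumr_const /=.
  apply: eq_big => // s _; rewrite gcoefMl; last first.
    by rewrite linear_sum summx_sub // => t _; apply: memR_G.
  rewrite linear_sum (bigD1 (s^-1 * 1)%g) //= gcoefG eqxx big1 ?addr0 // => t ts.
  by rewrite gcoefG eq_sym (negPf ts).
by rewrite linear_sum; apply: eq_bigr => s _; apply: barmG.
Qed.
End SpechtBasis.

(** * Cycle types *)

Section CycleType.
Variable F : fieldType.

Lemma bar_transport n m (s : 'S_n) (t : 'S_m) (w : 'I_m -> 'I_n) : bijective w ->
  (forall x, s (w x) = w (t x)) -> bar F s = bar F t.
Proof.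
move=> bw; have mn : m = n by have := bij_eq_card bw; rewrite !card_ord.
case: n / mn s w bw => s w bw sw.
rewrite -(bar_conj F t (perm (bij_inj bw))); congr (bar F _).
apply/permP => x; rewrite -[x](permKV (perm (bij_inj bw))) permJ.
by rewrite !permE sw.
Qed.

Definition pcycle k : KX F := bar F (perm (@ordS_inj k)).

(* Splits off the cycle of [s] that contains 0. *)
Lemma bar_split_cycle n (s : 'S_n) : (0 < n)%N ->
  exists m k (s' : 'S_m), [/\ (0 < k)%N, (m + k)%N = n & bar F s = bar F s' * pcycle k].
Proof.
move=> n0; pose x0 := Ordinal n0; pose O := porbit s x0.
have Os x : (s x \in ~: O) = (x \in ~: O).
  by rewrite !inE -!eq_porbit_mem -[s x]/((s ^+ 1)%g x) porbit_perm.
pose m := #|~: O|; pose k := #|O|.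
have k0 : (0 < k)%N by apply/card_gt0P; exists x0; apply: porbit_id.
have mk : (m + k)%N = n by rewrite addnC cardsC card_ord.
pose f (i : 'I_m) : 'I_m := enum_rank_in (enum_valP i) (s (enum_val i)).
have fE i : enum_val (f i) = s (enum_val i).
  by rewrite enum_rankK_in // Os; apply: enum_valP.
have f_inj : injective f.
  by move=> i j fij; apply/enum_val_inj/(@perm_inj _ s); rewrite -!fE fij.
(* [w] lists the complement of the orbit and then the orbit in the order in which [s] runs through
   it, so that [s] becomes a juxtaposition with the shift modulo k. *)
pose w (z : 'I_(m + k)) : 'I_n :=
  match split z with inl i => enum_val i | inr j => iter j s x0 end.
have wl i : w (lshift k i) = enum_val i.
  by rewrite /w -[lshift k i]/(unsplit (inl i)) unsplitK.
have wr j : w (rshift m j) = iter j s x0.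
  by rewrite /w -[rshift m j]/(unsplit (inr j)) unsplitK.
have iterO j : iter j s x0 \in O by rewrite -permX mem_porbit.
have w_inj : injective w.
  move=> y z; rewrite -[y]splitK -[z]splitK.
  case: (split y) => a; case: (split z) => b /=.
  - by rewrite !wl => /enum_val_inj ->.
  - by rewrite wl wr => ab; have := enum_valP a; rewrite ab inE iterO.
  - by rewrite wl wr => ab; have := enum_valP b; rewrite -ab inE iterO.
  rewrite !wr => ab; congr (rshift _ _); apply: val_inj => /=.
  have := nth_uniq x0 _ _ (uniq_traject_porbit s x0) => /(_ a b).
  by rewrite !size_traject !nth_traject // ab eqxx => /(_ _ _)/esym/eqP; apply.
exists m, k, (perm f_inj); split=> //.
rewrite /pcycle bar_mul; apply: (@bar_transport _ _ _ _ w).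
  by apply: inj_card_bij; rewrite // !card_ord mk.
move=> y; rewrite -[y]splitK; case: (split y) => a /=.
  by rewrite juxtl !wl permE fE.
rewrite juxtr !wr permE /= -iterS; have := ltn_ord a.
rewrite leq_eqVlt => /orP[/eqP ak|ak]; last by rewrite modn_small.
by rewrite ak modnn /= iter_porbit.
Qed.

Lemma bar_cycle_type n (s : 'S_n) :
  exists lam, [/\ is_part lam, sumn lam = n & bar F s = \prod_(l <- lam) pcycle l].
Proof.
have [N leN] := ubnP n; elim: N => // N IH in n s leN *.
have [n0|n0] := posnP n.
  move: s; rewrite n0 => s; exists [::]; split=> //; rewrite big_nil.
  have -> : 1 = bar F (1%g : 'S_0) by [].
  by congr (bar F _); apply/permP => -[].
have [m [k [s' [k0 mk ->]]]] := bar_split_cycle s n0.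
have [|lam [/andP[slam lam0] sm ->]] := IH m s'; first by lia.
exists (sort geq (k :: lam)); split.
- rewrite /is_part sort_sorted /=; last by move=> a b; apply: leq_total.
  by rewrite mem_sort inE negb_or lam0 andbT eq_sym -lt0n.
- by rewrite (perm_sumn (permEl (perm_sort _ _))) /= sm addnC.
by rewrite (perm_big _ (permEl (perm_sort _ _))) big_cons mulrC.
Qed.
End CycleType.

(** * The elements {lambda} span KX *)

Section ClassFunctional.
Variables (F : fieldType) (n : nat) (X : 'M[F]_#|[set: 'S_n]%G|).
Local Notation aG := (regular_repr F [set: 'S_n]%G).
Local Notation R_G := (group_ring F [set: 'S_n]%G).
Hypothesis R_X : (X \in R_G)%MS.
Hypothesis cX : forall g : 'S_n, aG g *m X = X *m aG g.

(** The function s -> coefficient of s X at 1 on the permutations of n points, extended by 0 to all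
    other degrees. Summing against an equality test avoids a cast. It is a class function because
    [X] is central. *)
Definition gfun (x : symperm) : F^o :=
  \sum_(g : 'S_n) (x == Tagged (fun n => 'S_n) g)%:R * gcoef 1 (aG g *m X).

Lemma gfunE (s : 'S_n) : gfun (Tagged (fun n => 'S_n) s) = gcoef 1 (aG s *m X).
Proof.
rewrite /gfun (bigD1 s) //= eqxx mul1r big1 ?addr0 // => g gs.
by rewrite eq_Tagged /= eq_sym (negPf gs) mul0r.
Qed.

Lemma gfunJ m (s t : 'S_m) :
  gfun (Tagged (fun n => 'S_n) (s ^ t)%g) = gfun (Tagged (fun n => 'S_n) s).
Proof.
have [mn|mn] := eqVneq m n; last first.
  rewrite /gfun !big1 // => g _.
    by rewrite (_ : _ == _ = false) ?mul0r //; apply: contra_neqF mn => /eqP/(congr1 tag).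
  by rewrite (_ : _ == _ = false) ?mul0r //; apply: contra_neqF mn => /eqP/(congr1 tag).
move: s t; rewrite mn => s t; rewrite !gfunE conjgE !regM -!mulmxA cX.
rewrite gcoef1C ?envelop_mxM ?memR_G //.
by rewrite -!mulmxA -regM mulgV repr_mx1 mulmx1 cX.
Qed.

Lemma KXlift_gfun_sum (I : finType) (a : I -> F) (x : I -> KX F) :
  KXlift gfun (\sum_i a i *: x i) = \sum_i a i * KXlift gfun (x i).
Proof.
pose mixin := GRing.isLinear.Build F (KX F) F^o *:%R (KXlift gfun) (KXlift_linear gfunJ).
pose g : {linear KX F -> F^o} := HB.pack (KXlift gfun) mixin.
rewrite -[LHS]/(g _) linear_sum; apply: eq_bigr => i _.
exact: (linearZ_LR g).
Qed.

Lemma KXlift_barm Y : (Y \in R_G)%MS -> KXlift gfun (barm Y) = gcoef 1 (Y *m X).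
Proof.
move=> RY; rewrite KXlift_gfun_sum {2}(gring_sum RY) mulmx_suml linear_sum.
apply: eq_bigr => s _; rewrite KXlift_bar ?gfunE => [|? ? ?]; last exact: gfunJ.
by rewrite -scalemxAl linearZ.
Qed.
End ClassFunctional.

Section Spanning.
Variable K : closedFieldType.
Hypothesis charK : [pchar K] =i pred0.

(** This says in dual form that the {lambda} span [KX]. In degree n one symmetrizer is taken for
    each cycle type that occurs, so the matrix expressing the symmetrizers in the cycle products is
    square. *)
Lemma sbr_separates (f : {linear KX K -> KX K}) :
  (forall lam, is_part lam -> f (sbr K lam) = 0) -> forall x, f x = 0.
Proof.
move=> f0; apply: KX_bar_ind => [|a x y fx fy|n s]; first exact: linear0.
  by rewrite linearP fx fy scaler0 addr0.
have ct (p : 'S_n) := bar_cycle_type K p.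
pose L := undup [seq projT1 (cid (ct p)) | p : 'S_n].
have Lct p : projT1 (cid (ct p)) \in L by rewrite mem_undup; apply: image_f.
have Lpart lam : lam \in L -> is_part lam /\ sumn lam = n.
  rewrite mem_undup => /imageP[p _ ->].
  by case: (projT2 (cid (ct p))).
pose N := size L; pose lam (i : 'I_N) := nth [::] L i.
have lamP i : is_part (lam i) /\ sumn (lam i) = n by apply/Lpart/mem_nth.
pose u (i : 'I_N) := \prod_(l <- lam i) pcycle K l.
have ix_lt p : (index (projT1 (cid (ct p))) L < N)%N by rewrite index_mem.
pose ix p := Ordinal (ix_lt p).
have uE p : bar K p = u (ix p).
  by rewrite /u /lam nth_index //; case: (projT2 (cid (ct p))).
(* The tableau of [lam i] is read on ['I_n] directly, as [sumn (lam i) = n] holds only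
   propositionally. *)
pose r i (x : 'I_n) := reshape_index (lam i) x.
pose k i (x : 'I_n) := reshape_offset (lam i) x.
pose c i := young K (r i) (k i).
have tr i : [/\ tableau (r i) (k i), below (k i) =1 below (@colf (lam i)) &
    sbr K (lam i) = (ycoef K (lam i))^-1 *: barm (c i)].
  rewrite (sbr_young charK) /c /r /k; case: (lamP i) => _; move: (lam i) => mu <-.
  by split=> //; apply: tableau_part.
have Rc i : (c i \in group_ring K [set: 'S_n]%G)%MS by apply: memR_young.
have nz2 : 2%:R != 0 :> K by apply: natK_neq0.
have c1 i : gcoef 1 (c i) = 1 by case: (tr i) => -[inj _] _ _; apply: gcoef1_young.
have cGc i g : exists a, c i *m regular_repr K [set: 'S_n]%G g *m c i = a *: c i.
  by case: (tr i) => tab _ _; apply: young_reg_young.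
have nzG : #|'S_n|%:R != 0 :> K by rewrite card_Sn; apply/natK_neq0/fact_gt0.
pose z i := conj_sum (c i).
have Rz i : (z i \in group_ring K [set: 'S_n]%G)%MS by apply: memR_conj_sum.
have cz i (g : 'S_n) : regular_repr K [set: 'S_n]%G g *m z i
    = z i *m regular_repr K [set: 'S_n]%G g.
  by apply/esym/conj_sumC/memR_G.
pose phi i := KXlift (gfun (z i)).
have phiS j (a : 'I_N -> K) x : phi j (\sum_i a i *: x i) = \sum_i a i * phi j (x i).
  exact: KXlift_gfun_sum.
have phiE i j : phi j (barm (c i)) = gcoef 1 (c i *m z j) by apply: KXlift_barm.
have phi0 i j : i != j -> phi j (barm (c i)) = 0.
  move=> ij; rewrite phiE; have [ti bi _] := tr i; have [tj bj _] := tr j.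
  have [m bm] : exists m, below (k i) m != below (k j) m.
    apply: contrapT => nb; case/eqP: ij; apply: val_inj.
    apply/eqP; rewrite -(nth_uniq [::] (ltn_ord i) (ltn_ord j) (undup_uniq _)).
    apply/eqP/part_below_inj; [exact: (lamP i).1 | exact: (lamP j).1 | move=> m].
    by apply/eqP/negPn/negP => bm; apply: nb; exists m; rewrite bi bj.
  exact: gcoef_young_conj_sum0 bm.
have phi1 i : phi i (barm (c i)) != 0.
  rewrite phiE (gcoef_conj_sum_qprim (Rc i) (c1 i) (cGc i)).
  by apply/expf_neq0/kap_neq0.
(* [A] expands the symmetrizers in the cycle products [u j], and the [phi j] are dual
   to the symmetrizers up to nonzero scalars, so [A *m B] is diagonal and invertible. *)
pose A := \matrix_(i < N, j < N) \sum_(p | ix p == j) gcoef p (c i).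
pose B := \matrix_(l < N, j < N) phi j (u l).
have cE i : barm (c i) = \sum_j A i j *: u j.
  rewrite /barm (partition_big ix predT) //=; apply: eq_bigr => j _.
  rewrite mxE scaler_suml; apply: eq_bigr => p /eqP <-.
  by rewrite uE.
have AB : A *m B = diag_mx (\row_i phi i (barm (c i))).
  apply/matrixP => i j; rewrite !mxE; have [<-|ij] := eqVneq i j.
    rewrite mulr1n [in RHS]cE phiS.
    by apply: eq_bigr => l _; rewrite [B l i]mxE.
  rewrite mulr0n; transitivity (phi j (barm (c i))); last exact: phi0.
  by rewrite cE phiS; apply: eq_bigr => l _; rewrite [B l j]mxE.
have uD : diag_mx (\row_i phi i (barm (c i))) \in unitmx.
  rewrite unitmxE det_diag unitfE; apply/prodf_neq0 => i _.
  by rewrite mxE phi1.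
have uA : A \in unitmx.
  have /mulmx1_unit[] // : A *m (B *m invmx (diag_mx (\row_i phi i (barm (c i))))) = 1%:M.
  by rewrite mulmxA AB mulmxV.
have fc i : \sum_j A i j *: f (u j) = 0.
  transitivity (f (barm (c i))).
    by rewrite cE linear_sum; apply: eq_bigr => j _; rewrite linearZ.
  have [_ _ sE] := tr i; apply/eqP; have := f0 _ (lamP i).1; rewrite sE linearZ /= => /eqP.
  by rewrite scaler_eq0 invr_eq0 (negPf (ycoef_neq0 charK _)).
rewrite uE; move: (ix s) => j.
transitivity (\sum_l (invmx A *m A) j l *: f (u l)).
  rewrite mulVmx // (bigD1 j) //= mxE eqxx scale1r big1 ?addr0 // => l lj.
  by rewrite mxE eq_sym (negPf lj) scale0r.
under eq_bigr do rewrite mxE scaler_suml.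
rewrite exchange_big big1 //= => i _.
by under eq_bigr do rewrite -scalerA; rewrite -scaler_sumr fc scaler0.
Qed.

Lemma tsign_unique (t : KX K -> KX K) : is_transposition t -> t = @tsign K.
Proof.
move=> [lt tE]; apply: funext => x; apply/eqP; rewrite -subr_eq0; apply/eqP.
pose mixin := GRing.isLinear.Build K (KX K) (KX K) *:%R t lt.
pose g : {linear KX K -> KX K} := HB.pack t mixin.
rewrite -[LHS]/((g \- @tsign K) x); apply: sbr_separates => lam plam /=.
by rewrite tE // tsign_sbr ?subrr //; case/andP: plam.
Qed.

(** [tsign] witnesses existence, so the definition does not fall back on the zero map, and
    uniqueness identifies the map chosen there. *)
Lemma transpositionE : transposition K = @tsign K.
Proof.
rewrite /transposition; case: pselect => [h|[]].
  by apply/tsign_unique/(projT2 (cid h)).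
exists (@tsign K); split=> [|lam /andP[slam _]]; first exact: linearP.
exact: tsign_sbr.
Qed.
End Spanning.

From mathcomp Require Import classical_sets mpoly.

(** * Polynomials vanishing everywhere *)

(** Uniqueness of digits in base [N]: the lowest digit is the residue modulo [N], and induction
    gives the others. *)
Lemma digits_inj N n (a b : 'I_n -> nat) :
  (forall i, a i < N)%N -> (forall i, b i < N)%N ->
  (\sum_i a i * N ^ i)%N = (\sum_i b i * N ^ i)%N -> a =1 b.
Proof.
elim: n a b => [|n IH] a b aN bN; first by move=> _ [].
have N0 : (0 < N)%N by apply: leq_ltn_trans (aN ord0).
have digE (c : 'I_n.+1 -> nat) : (\sum_i c i * N ^ i)%N =
    ((\sum_(i < n) c (lift ord0 i) * N ^ i) * N + c ord0)%N.
  rewrite big_ord_recl muln1 addnC; congr (_ + _)%N; rewrite big_distrl.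
  by apply: eq_bigr => i _ /=; rewrite /bump add1n expnSr mulnA.
rewrite !digE => eqab; have e0 : a ord0 = b ord0.
  by have := congr1 (modn^~ N) eqab; rewrite !modnMDl !modn_small.
have {}eqab : a \o lift ord0 =1 b \o lift ord0.
  apply: IH => [i|i|]; rewrite /= ?aN ?bN //; apply/eqP.
  by rewrite -(eqn_pmul2r N0) -(eqn_add2r (a ord0)) eqab e0.
by move=> i; case: (unliftP ord0 i) => [j ->|->] //; apply: eqab.
Qed.

Section InfiniteField.
Variable K : closedFieldType.
Hypothesis charK : [pchar K] =i pred0.

Lemma natK_inj : injective (fun n => n%:R : K).
Proof.
move=> m n; wlog le : m n / (m <= n)%N => [W e|].
  by case/orP: (leq_total m n) => le; [|symmetry]; apply: W.
move=> e; apply/eqP; rewrite eqn_leq le -subn_eq0 -((pcharf0P K).1 charK).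
by rewrite natrB // e subrr eqxx.
Qed.

Lemma poly_vanish (q : {poly K}) : (forall x, q.[x] = 0) -> q = 0.
Proof.
move=> q0; apply/eqP; apply: contraT => nzq.
have := max_poly_roots (rs := [seq i%:R | i <- iota 0 (size q)]) nzq.
rewrite size_map size_iota ltnn map_inj_uniq ?iota_uniq; last exact: natK_inj.
by move=> -> //; apply/allP => x _; rewrite /root q0.
Qed.

(* Kronecker's substitution x_i := x^(N^i) reduces to one variable. *)
Lemma mpoly_vanish n (p : {mpoly K[n]}) : (forall v, p.@[v] = 0) -> p = 0.
Proof.
(* [N] exceeds every exponent occurring in [p], so distinct monomials of [p] become distinct powers
   of x. *)
move=> p0; pose N := (\max_(m <- msupp p) mdeg m).+1.
have lt_mN m i : m \in msupp p -> (m i < N)%N.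
  move=> mp; rewrite ltnS; apply: (@leq_trans (mdeg m)); last first.
    by rewrite (big_rem m) //= leq_maxl.
  by rewrite mdegE (bigD1 i) //= leq_addr.
pose e (m : 'X_{1..n}) := (\sum_i m i * N ^ i)%N.
pose q : {poly K} := \sum_(m <- msupp p) p@_m *: 'X^(e m).
have q0 : q = 0.
  apply: poly_vanish => x; rewrite -(p0 (fun i => x ^+ (N ^ i))).
  rewrite mevalE horner_sum; apply: eq_bigr => m _.
  rewrite hornerZ hornerXn; congr (_ * _); rewrite expr_sum.
  by apply: eq_bigr => i _; rewrite -exprM mulnC.
apply/mpolyP => m; rewrite mcoeff0; apply/eqP; apply: contraT => pm.
have mp : m \in msupp p by rewrite mcoeff_msupp.
have := coef0 K (e m); rewrite -q0 coef_sum (bigD1_seq m) //= coefZ coefXn eqxx mulr1.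
rewrite big_seq_cond big1 ?addr0 => [/eqP|m' /andP[mp' m'm]]; first by rewrite (negPf pm).
rewrite coefZ coefXn; case: eqP => [em|]; last by rewrite mulr0.
case/eqP: m'm; apply/mnmP => i.
by rewrite (digits_inj (fun i => lt_mN m i mp) (fun i => lt_mN m' i mp') em).
Qed.
End InfiniteField.

(** * Generators and their invariants *)

Lemma sumr_const_scale (F : fieldType) (V : lmodType F) (T : finType) (P : pred T) (x : V) :
  \sum_(i | P i) x = #|[pred i | P i]|%:R *: x.
Proof. by rewrite sumr_const scaler_nat. Qed.

Section Generators.
Variable K : closedFieldType.
Hypothesis charK : [pchar K] =i pred0.

Section Generation.
Variable P : KX K -> Prop.
Hypothesis P1 : P 1.
Hypothesis PD : forall a x y, P x -> P y -> P (a *: x + y).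
Hypothesis PM : forall x y, P x -> P y -> P (x * y).
Hypothesis PX : forall k, (0 < k)%N -> P (Xvar K k).

Let P0 : P 0.
Proof. by rewrite -(addNr 1) -scaleN1r; apply: PD. Qed.

Let Psum (I : finType) (Q : pred I) (f : I -> KX K) :
  (forall i, Q i -> P (f i)) -> P (\sum_(i | Q i) f i).
Proof. by move=> Pf; apply: (big_ind P) => // x y Px Py; rewrite -[x]scale1r; apply: PD. Qed.

Let PZ a x : P x -> P (a *: x).
Proof. by move=> Px; rewrite -[_ *: _]addr0; apply: PD. Qed.

(** Up to n!, X_n is the sum of all permutation classes. The class of the n-cycle occurs in it with
    a positive integer coefficient, invertible in characteristic zero; every other class is a
    product of shorter cycles, covered by induction. *)
Lemma Xvar_gen_pcycle n : (0 < n)%N -> P (pcycle K n).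
Proof.
elim/ltn_ind: n => n IH n0.
have bar_or (s : 'S_n) : bar K s != pcycle K n -> P (bar K s).
  have [lam [/andP[_ lam0] sz ->]] := bar_cycle_type K s.
  (* A cycle type of n that contains n has no other part, since its parts are positive. *)
  have [nl|nl] := boolP (n \in lam).
    have pl := perm_to_rem nl; have := sz; rewrite (perm_sumn pl) /= => /eqP.
    rewrite -[X in _ == X]addn0 eqn_add2l => /eqP sz0.
    have rem0 : rem n lam = [::].
      case: (rem n lam) pl sz0 => // a r pl /= /eqP; rewrite addn_eq0 => /andP[/eqP a0 _].
      by move: lam0; rewrite (perm_mem pl) a0 !inE eqxx orbT.
    by rewrite (perm_big _ pl) rem0 big_seq1 eqxx.
  move=> _; rewrite big_seq; apply: (big_ind P) => // l ll; apply: IH.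
    have : (l <= sumn lam)%N by rewrite (perm_sumn (perm_to_rem ll)) leq_addr.
    by rewrite sz leq_eqVlt => /orP[/eqP ln|//]; rewrite -ln ll in nl.
  by rewrite lt0n; apply: contraNneq lam0 => l0; rewrite l0 in ll.
have [c c0 cE] : exists2 c : K, c != 0 &
    \sum_(s : 'S_n | bar K s == pcycle K n) bar K s = c *: pcycle K n.
  exists (#|[pred s : 'S_n | bar K s == pcycle K n]|%:R).
    by apply: (natK_neq0 charK); apply/card_gt0P; exists (perm (@ordS_inj n)); rewrite inE.
  rewrite (eq_bigr (fun=> pcycle K n)) => [|s /eqP->]; last by [].
  exact: sumr_const_scale.
have sumE : n`!%:R *: Xvar K n = c *: pcycle K n +
    \sum_(s : 'S_n | bar K s != pcycle K n) bar K s.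
  rewrite (Xvar_sum charK) scalerA mulfV ?scale1r; last exact/(natK_neq0 charK)/fact_gt0.
  by rewrite (bigID (fun s : 'S_n => bar K s == pcycle K n)) /= cE.
rewrite -[pcycle K n]scale1r -(mulVf c0) -scalerA; apply: PZ.
rewrite (canRL (addrK _) (esym sumE)) -[- _]scaleN1r addrC.
by apply: PD; [apply: Psum => s; apply: bar_or | apply/PZ/PX].
Qed.

Lemma Xvar_gen x : P x.
Proof.
elim/KX_bar_ind: x => // n s.
have [lam [/andP[_ lam0] _ ->]] := bar_cycle_type K s.
rewrite big_seq; apply: (big_ind P) => // l ll; apply: Xvar_gen_pcycle.
by rewrite lt0n; apply: contraNneq lam0 => l0; rewrite l0 in ll.
Qed.
End Generation.

Definition evar k : KX K := tsign (Xvar K k).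

Variable d : nat.

Lemma PhiS (T : 'M[K]_d) (I : finType) (f : I -> KX K) :
  Phi (\sum_i f i) T = \sum_i Phi (f i) T.
Proof. by apply: (big_morph (fun x => Phi x T)) => [x y|]; rewrite ?PhiD ?Phi0. Qed.

(** Once the sums are exchanged, the signed sum over permutations is the Leibniz expansion of a
    determinant. *)
Lemma Phi_evar k (T : 'M[K]_d) : Phi (evar k) T =
  k`!%:R^-1 * \sum_(f : {ffun 'I_k -> 'I_d}) \det (\matrix_(i, j) T (f j) (f i)).
Proof.
rewrite /evar (Xvar_sum charK) linearZ /= PhiZ linear_sum PhiS; congr (_ * _).
rewrite exchange_big /=; apply: eq_bigr => s _.
rewrite tsign_bar PhiZ Phi_cls monalg.mmapU mul1r trace_funE mulr_sumr.
apply: eq_bigr => f _; congr (_ * _); apply: eq_bigr => i _.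
by rewrite mxE.
Qed.

Lemma Phi_evar_gt k (T : 'M[K]_d) : (d < k)%N -> Phi (evar k) T = 0.
Proof.
move=> dk; rewrite Phi_evar big1 ?mulr0 // => f _.
have [/injectiveP/leq_card|/injectivePn [i [j ij fij]]] := boolP (injectiveb f).
  by rewrite !card_ord leqNgt dk.
by apply: (determinant_alternate ij) => l; rewrite !mxE fij.
Qed.

(** A map [f] with a repeated value contributes 0; an injective one gives a diagonal matrix. Each
    k-subset is the image of k! injective maps, which cancels the factor 1/k!. *)
Lemma Phi_evar_diag k (t : 'rV[K]_d) : Phi (evar k) (diag_mx t) = (mesym d K k).@[t 0].
Proof.
have detE (f : {ffun 'I_k -> 'I_d}) : \det (\matrix_(i, j) diag_mx t (f j) (f i)) =
    if injectiveb f then \prod_i t 0 (f i) else 0.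
  case: ifPn => [/injectiveP finj|/injectivePn [i [j ij fij]]]; last first.
    by apply: (determinant_alternate ij) => l; rewrite !mxE fij.
  transitivity (\prod_i (\row_i t 0 (f i)) 0 i); last by apply: eq_bigr => i _; rewrite mxE.
  rewrite -det_diag; congr (\det _); apply/matrixP => i j; rewrite !mxE.
  by rewrite (inj_eq finj) eq_sym; case: eqP => [->|].
rewrite Phi_evar; under eq_bigr do rewrite detE.
rewrite -big_mkcond /= /mesym raddf_sum /=.
rewrite (partition_big (fun f : {ffun 'I_k -> 'I_d} => f @: [set: 'I_k]%SET)
  (fun h : {set 'I_d} => #|h| == k)) /=; last first.
  by move=> f /injectiveP finj; rewrite card_imset // cardsT card_ord.
rewrite mulr_sumr; apply: eq_bigr => h /eqP hk.
rewrite (eq_bigr (fun=> \prod_(i in h) t 0 i)) => [|f /andP[/injectiveP finj /eqP <-]].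
  rewrite sumr_const rmorph_prod /=.
  under [RHS]eq_bigr do rewrite mevalXU.
  rewrite -[X in _ * X = _]mulr_natl mulrA (_ : #|_| = k`!) ?mulVf ?mul1r //.
    exact/(natK_neq0 charK)/fact_gt0.
  have := card_inj_ffuns_on 'I_k (mem h); rewrite card_ord hk ffactnn => <-.
  apply: eq_card => f; rewrite !inE; apply/andP/andP => -[].
    move=> finj /eqP <-; split=> //; apply/ffun_onP => i; exact: imset_f.
  move=> /ffun_onP fh finj; split=> //; rewrite eqEcard; apply/andP; split.
    by apply/fintype.subsetP => _ /imsetP[i _ ->].
  by rewrite card_imset ?cardsT ?card_ord ?hk //; apply/injectiveP.
rewrite big_imset /=; last by move=> i j _ _; apply: finj.
by apply: eq_bigl => i; rewrite inE.
Qed.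
End Generators.

(** * The kernel and the quotient *)

Local Open Scope classical_set_scope.

Section Presentation.
Variable K : closedFieldType.
Hypothesis charK : [pchar K] =i pred0.
Variable d : nat.

(** Ordinals start at 0, so the variable with index i is sent to e_(i+1). *)
Definition evar_map : {mpoly K[d]} -> KX K :=
  mmap (in_alg (KX K)) (fun i : 'I_d => evar K i.+1).
HB.instance Definition _ := GRing.RMorphism.on evar_map.

Lemma evar_mapZ : scalable evar_map.
Proof. by move=> a p; rewrite /evar_map mmapZ mulr_algl. Qed.
HB.instance Definition _ :=
  GRing.isScalable.Build K {mpoly K[d]} (KX K) *:%R evar_map evar_mapZ.

Lemma PhiX x n (T : 'M[K]_d) : Phi (x ^+ n) T = Phi x T ^+ n.
Proof. by elim: n => [|n IH]; rewrite ?expr0 ?Phi1 // !exprS PhiM IH. Qed.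

Lemma Phi_evar_map p (t : 'rV[K]_d) : Phi (evar_map p) (diag_mx t) =
  (p \mPo [tuple mesym d K i.+1 | i < d]).@[t 0].
Proof.
rewrite comp_mpoly_meval mevalE /evar_map /mmap.
rewrite (big_morph (fun x => Phi x (diag_mx t)) (id1 := 0) (op1 := +%R)) => [|x y|];
  rewrite ?PhiD ?Phi0 //.
apply: eq_bigr => m _; rewrite mulr_algl PhiZ; congr (_ * _).
rewrite (big_morph (fun x => Phi x (diag_mx t)) (id1 := 1) (op1 := *%R)) => [|x y|];
  rewrite ?PhiM ?Phi1 //.
by apply: eq_bigr => i _; rewrite PhiX Phi_evar_diag // tnth_mktuple.
Qed.

(** Restricted to diagonal matrices, the hypothesis says that p(e_1, ..., e_d) vanishes at every
    point, e_i being elementary symmetric. It is then the zero polynomial, and algebraic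
    independence gives p = 0. *)
Lemma evar_map_ker p : evar_map p \in kerPhi K d -> p = 0.
Proof.
move=> /asboolP ker0; apply: msym_fundamental_un0; apply: mpoly_vanish => // v.
rewrite -(meval_eq (v1 := (\row_i v i) 0)) => [|i]; last by rewrite mxE.
by rewrite -Phi_evar_map.
Qed.

Local Notation J := (ideal_gen [set evar K k | k in [set k : nat | (d < k)%N]]).

Lemma ideal_genM (a x : KX K) : J x -> J (a * x).
Proof. exact: (@lspanZ _ (KX K)^o). Qed.

Lemma evar_decomp x : exists p r, x = evar_map p + r /\ J r.
Proof.
have JD := @lspanD (KX K) (KX K)^o; have JM := ideal_genM.
have J0 : J 0 by apply: lspan0.
(* Writing x as the image of y under [tsign] turns generation by the X_k into generation by the
   e_k. *)
rewrite -[x]tsignK; move: (tsign x) => y.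
elim/(Xvar_gen charK): y.
- by exists 1, 0; rewrite !rmorph1 addr0.
- move=> a y z [p [r [py Jr]]] [q [s [qz Js]]]; exists (a *: p + q), (a%:A * r + s).
  split; last by apply: JD => //; apply: JM.
  by rewrite linearP /= py qz linearP /= mulr_algl scalerDr addrACA.
- move=> y z [p [r [py Jr]]] [q [s [qz Js]]].
  exists (p * q), (evar_map p * s + (evar_map q + s) * r); split.
    rewrite tsignM py qz [evar_map (p * q)]rmorphM mulrDl mulrDr -addrA.
    by rewrite [r * _]mulrC.
  by apply: JD; apply: JM.
move=> k k0; rewrite -/(evar K k).
have [kd|dk] := leqP k d.
  case: k k0 kd => // k _ kd; exists 'X_(Ordinal kd), 0; split=> //.
  by rewrite addr0 /evar_map mmapX mmap1U.
exists 0, (evar K k); rewrite rmorph0 add0r; split=> //.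
by apply: lspan_incl; exists k.
Qed.

Lemma J_sub_ker x : J x -> x \in kerPhi K d.
Proof.
move=> [r [rS ->]]; rewrite big_seq; apply: rpred_sum => c /rS [k dk <-].
rewrite -mulr_algl; apply: idealMr; apply/asboolP => T.
exact: Phi_evar_gt.
Qed.

(** In the decomposition x = p(e_1, ..., e_d) + r the remainder lies in the kernel; if x does too,
    so does the polynomial part, which is therefore zero. *)
Lemma kerPhiE x : x \in kerPhi K d <-> J x.
Proof.
split; last exact: J_sub_ker.
have [p [r [-> Jr]]] := evar_decomp x; have kr := J_sub_ker Jr.
by rewrite rpredDr // => /evar_map_ker ->; rewrite rmorph0 add0r.
Qed.

Lemma tsign_ideal (S S' : set (KX K)) x : (forall y, S y -> S' (tsign y)) ->
  ideal_gen S x -> ideal_gen S' (tsign x).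
Proof.
move=> SS' [r [rS ->]]; rewrite rmorph_sum big_seq.
apply: (big_ind (ideal_gen S')) => [|y z|c /rS Sc]; first exact: lspan0.
  exact: (@lspanD _ (KX K)^o).
rewrite rmorphM; apply: (@lspanZ _ (KX K)^o); apply: lspan_incl; exact: SS'.
Qed.

Lemma transposition_kerPhi : transposition K @` [set` kerPhi K d] =
  ideal_gen [set Xvar K k | k in [set k : nat | (d < k)%N]].
Proof.
rewrite (transpositionE charK); apply/seteqP; split=> [_ [x /kerPhiE Jx <-]|x Xx].
  by apply: tsign_ideal Jx => _ [k dk <-]; exists k; rewrite // /evar tsignK.
exists (tsign x); last exact: tsignK.
by apply/kerPhiE; apply: tsign_ideal Xx => _ [k dk <-]; exists k.
Qed.

(** The map starts from the polynomial ring, where morphisms are given by values on variables; the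
    isomorphism wanted is its inverse. *)
Definition quot_map : {mpoly K[d]} -> {ideal_quot (kerPhi K d)} :=
  \pi_{ideal_quot (kerPhi K d)}%qT \o evar_map.
HB.instance Definition _ := GRing.RMorphism.on quot_map.

Lemma quot_mapZ : scalable quot_map.
Proof. by move=> a p; rewrite /quot_map /= linearZ /= [RHS]piE. Qed.
HB.instance Definition _ := GRing.isScalable.Build K _ _ *:%R quot_map quot_mapZ.

Lemma quot_map_bij : bijective quot_map.
Proof.
have inj : injective quot_map.
  apply: raddf_inj => p /eqP; rewrite /quot_map /= -(rmorph0 \pi_{ideal_quot (kerPhi K d)}%qT).
  by rewrite -Quotient.idealrBE subr0 => /evar_map_ker.
have surj y : exists p, quot_map p = y.
  have [p [r [xE Jr]]] := evar_decomp (repr y); exists p; rewrite -[y]reprK xE /quot_map /=.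
  apply/eqP; rewrite -Quotient.idealrBE opprD addrA subrr add0r rpredN.
  exact: J_sub_ker.
exists (fun y => projT1 (cid (surj y))) => x; last exact: (projT2 (cid (surj x))).
by apply: inj; exact: (projT2 (cid (surj _))).
Qed.

Lemma quot_iso :
  exists f : {lrmorphism {ideal_quot (kerPhi K d)} -> {mpoly K[d]}}, bijective f.
Proof.
have [g gK Kg] := quot_map_bij.
have gB : zmod_morphism g := can2_zmod_morphism gK Kg.
have gM : monoid_morphism g := can2_monoid_morphism gK Kg.
have gZ : scalable g := can2_scalable gK Kg.
pose mB := GRing.isZmodMorphism.Build _ _ g gB.
pose mM := GRing.isMonoidMorphism.Build _ _ g gM.
pose mZ := GRing.isScalable.Build K _ _ *:%R g gZ.
pose f : {lrmorphism {ideal_quot (kerPhi K d)} -> {mpoly K[d]}} := HB.pack g mB mM mZ.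
by exists f; exists quot_map.
Qed.
End Presentation.

Theorem lemma10p5 (K : closedFieldType) (charK : [pchar K] =i pred0) (d : nat) :
  transposition K @` [set` kerPhi K d] =
    ideal_gen [set Xvar K k | k in [set k : nat | (d < k)%N]] /\
  exists f : {lrmorphism {ideal_quot (kerPhi K d)} -> {mpoly K[d]}},
    bijective f.
Proof.
split; [exact: transposition_kerPhi | exact: quot_iso].
Qed.
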